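(* Let $p$ be a positive integer and let $a_1,\ldots,a_{2p-1}$ be real, distinct, non-zero numbers. Let $A_j:=A(a_j)$ for $j=1,\ldots,2p-1$, let $P_a$ be the polynomial defined below, and let $M_{m,p,a}$ ($m\ge 0$) be the matrices defined below. Let $0<R\le\infty$. Suppose that $\det M_{m,p,a}\neq 0$ for all integers $m\geq 0$ and that $$\tau:=\liminf_{m\to\infty}\left|\det M_{m,p,a}\right|^{1/m}>0.$$ Then for every $f,g\in A(B_R)$ the homogeneous Goursat problem $$\Delta^p u=f,\qquad P_a \mid (u-g)$$ has a unique solution $u\in A(B_{\tau R})$.
   Context: $\Delta=\partial^2/\partial x^2+\partial^2/\partial y^2$ is the Laplace operator on $\mathbb R^2$. For $0<R\le\infty$, $B_R=\{(x,y)\in\mathbb R^2: x^2+y^2<R^2\}$, and $A(B_R)$ denotes the algebra of all $C^\infty$ functions $f:B_R\to\mathbb C$ such that for every compact $K\subset B_R$ the homogeneous Taylor series $\sum_{m\ge0} f_m(x,y)$ of $f$ at $0$ (where $f_m(x,y)=\sum_{k+l=m}\frac{1}{k!\,l!}\frac{\partial^m f}{\partial x^k\partial y^l}(0)x^ky^l$) converges absolutely and uniformly to $f$ on $K$. For a real number $a$, $A(a):=\frac{a+i}{a-i}$ (a unimodular complex number). For $a=(a_1,\dots,a_{2p-1})$, $P_a(x,y):=y\prod_{j=1}^{2p-1}(x-a_jy)$. For $m\ge0$, $M_{m,p,a}$ is the $2p\times 2p$ matrix whose first row is $(1,1,\ldots,1)$ and whose $(j+1)$-th row, $j=1,\ldots,2p-1$,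 is $(1,A_j,A_j^2,\ldots,A_j^{p-1},A_j^{m+p+1},A_j^{m+p+2},\ldots,A_j^{m+2p})$. The condition $P_a\mid(u-g)$ means that $u-g=P_a q$ for some real-analytic $q$ (here $q\in A(B_{\tau R})$), i.e. $P_a$ divides $u-g$ in the ring of germs of real-analytic functions at $0$. *)

(* Defs.v *)
From HB Require Import structures.
From mathcomp Require Import all_boot all_order all_algebra.
From mathcomp Require Import all_classical all_reals all_analysis.
From mathcomp Require Import complex.
Set Implicit Arguments. Unset Strict Implicit. Unset Printing Implicit Defensive.
Import Order.TTheory GRing.Theory Num.Theory numFieldTopology.Exports numFieldNormedType.Exports.
Local Open Scope classical_set_scope.
Local Open Scope ring_scope.
Local Open Scope complex_scope.

Section Goursat.
Variable R : realType.

Definition cmod (z : R[i]) : R := Num.sqrt (complex.Re z ^+ 2 + complex.Im z ^+ 2).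

Definition disc (r : \bar R) : set (R * R) :=
  [set z | ((Num.sqrt (z.1 ^+ 2 + z.2 ^+ 2))%:E < r)%E].

Definition dx (f : R * R -> R[i]) : R * R -> R[i] := fun z =>
  (derive1 (fun t => complex.Re (f (t, z.2))) z.1) +i* (derive1 (fun t => complex.Im (f (t, z.2))) z.1).
Definition dy (f : R * R -> R[i]) : R * R -> R[i] := fun z =>
  (derive1 (fun t => complex.Re (f (z.1, t))) z.2) +i* (derive1 (fun t => complex.Im (f (z.1, t))) z.2).

Definition Dseq (s : seq bool) (f : R * R -> R[i]) : R * R -> R[i] :=
  foldr (fun b g => if b then dx g else dy g) f s.

Definition smooth_on (U : set (R * R)) (f : R * R -> R[i]) : Prop :=
  forall s : seq bool, forall z, U z ->
    [/\ derivable (fun t => complex.Re (Dseq s f (t, z.2))) z.1 1,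
        derivable (fun t => complex.Im (Dseq s f (t, z.2))) z.1 1,
        derivable (fun t => complex.Re (Dseq s f (z.1, t))) z.2 1 &
        derivable (fun t => complex.Im (Dseq s f (z.1, t))) z.2 1] /\
    {for z, continuous (fun w : R * R => complex.Re (Dseq s f w))} /\
        {for z, continuous (fun w : R * R => complex.Im (Dseq s f w))}.

Definition tcoef (f : R * R -> R[i]) (k l : nat) : R[i] :=
  Dseq (nseq k true ++ nseq l false) f (0, 0).

Definition fhom (f : R * R -> R[i]) (m : nat) (z : R * R) : R[i] :=
  \sum_(k < m.+1)
     tcoef f k (m - k) / ((k`! * (m - k)`!)%:R) * (z.1 ^+ k)%:C * (z.2 ^+ (m - k))%:C.

Definition Aan (r : \bar R) (f : R * R -> R[i]) : Prop :=
  smooth_on (disc r) f /\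
  forall K : set (R * R), compact K -> K `<=` disc r ->
    (forall e : R, 0 < e -> exists N : nat, forall n1 n2 : nat, (N <= n1)%N ->
        forall z, K z -> \sum_(n1 <= m < n2) cmod (fhom f m z) < e) /\
    (forall e : R, 0 < e -> exists N : nat, forall n : nat, (N <= n)%N ->
        forall z, K z -> cmod (f z - \sum_(m < n) fhom f m z) < e).

Definition laplace (u : R * R -> R[i]) : R * R -> R[i] :=
  fun z => dx (dx u) z + dy (dy u) z.

Definition Acx (a : R) : R[i] := (a%:C + 'i) / (a%:C - 'i).

(* P_a(x,y) = y * prod_{j=1}^{2p-1} (x - a_j y); a_j is stored as a j.-1 *)
Definition Pa (p : nat) (a : nat -> R) (z : R * R) : R :=
  z.2 * \prod_(j < (2 * p).-1) (z.1 - a j * z.2).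

Definition Mmat (m p : nat) (a : nat -> R) : 'M[R[i]]_(2 * p) :=
  \matrix_(i, j) (if (i : nat) == 0%N then 1
                  else Acx (a (i : nat).-1) ^+ (if (j < p)%N then (j : nat) else (m + j + 1)%N)).

Definition tau (p : nat) (a : nat -> R) : \bar R :=
  limn_einf (fun m : nat => ((cmod (\det (Mmat m p a))) `^ (m%:R^-1))%:E).

End Goursat.

(* Main.v *)
(* In the coordinates [zeta = x + iy], [zeta' = x - iy] a function of [A(B_r)] is a series
   [sum_(k, l) c k l * zeta^k * zeta'^l] with [|c k l| rho^(k+l)] bounded for every [rho < r]:
   averaging over roots of unity bounds each coefficient of a homogeneous polynomial by its
   maximum on the circle of radius [rho]. Since the Laplacian is [4 d/dzeta d/dzeta'],
   [Delta^p u = f] prescribes exactly the coefficients [c k l] with [k, l >= p]. On the line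
   [x = a_j y] one has [zeta = A_j zeta'], and on [y = 0] one has [zeta = zeta'], so the
   requirement that [u = g] on the zero set of [P_a] becomes, in degree [m + 2p], a linear
   system with matrix [M_m] for the [2p] remaining coefficients. Cramer's rule loses a factor
   [1 / |det M_m|], which shrinks the radius by at most [tau]. Finally, dividing
   [(u - g)_(m+2p)] by the unimodular linear factors of [P_a] costs only a polynomial factor
   in [m]. *)
Require Import Defs.
From HB Require Import structures.
From mathcomp Require Import all_boot all_order all_algebra.
From mathcomp Require Import all_classical all_reals all_analysis.
From mathcomp Require Import complex.
From mathcomp Require Import perm cyclotomic separable cyclic zify ring lra.
Set Implicit Arguments. Unset Strict Implicit. Unset Printing Implicit Defensive.
Import Order.TTheory GRing.Theory Num.Theory numFieldTopology.Exports numFieldNormedType.Exports.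
Local Open Scope classical_set_scope.
Local Open Scope ring_scope.
Local Open Scope complex_scope.

(** * Moduli and convergent complex series *)

Section ComplexSeries.
Variable R : realType.
Implicit Types (x y : R) (z w s : R[i]) (u v : nat -> R[i]).

(** Convergence in [Aan] is by homogeneous blocks, while the construction works on single
    coefficients; [has_series] joins the two descriptions. No radius is lost between them, because a
    factor polynomial in the degree is absorbed by a slightly larger radius. The derivatives in the
    definitions are real partial derivatives of real and imaginary parts, so termwise
    differentiation and the identification of the blocks with Taylor polynomials have to be proved;
    the former comes from a summable second-order remainder. Degrees below 2p are special: the
    Laplacian prescribes no coefficient there and a multiple of [Pa] has no part there, so u copies
    g. Uniqueness in these degrees holds because a form of degree below 2p cannot vanish at 2p
    distinct nodes. A radius below tau times [Rad] is a product s rho' with s < tau and rho' <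
    [Rad]: s^m pays for the inverse determinant and rho' for the growth of f and g. As the nodes are
    unimodular, the determinants are at most (2p)!, so tau <= 1 and the data live on the disc of the
    solution. *)

Lemma cmodE z : cmod z = Normc.normc z.
Proof. by case: z. Qed.

Lemma cmod_ge0 z : 0 <= cmod z.
Proof. exact: sqrtr_ge0. Qed.

Lemma cmod0 : cmod (0 : R[i]) = 0.
Proof. by rewrite cmodE Normc.normc0. Qed.

Lemma cmod1 : cmod (1 : R[i]) = 1.
Proof. by rewrite cmodE Normc.normc1. Qed.

Lemma cmodM z w : cmod (z * w) = cmod z * cmod w.
Proof. by rewrite !cmodE Normc.normcM. Qed.

Lemma cmodV z : cmod z^-1 = (cmod z)^-1.
Proof. by rewrite !cmodE Normc.normcV. Qed.

Lemma cmodN z : cmod (- z) = cmod z.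
Proof. by rewrite /cmod; case: z => a b /=; rewrite !sqrrN. Qed.

Lemma cmodD z w : cmod (z + w) <= cmod z + cmod w.
Proof.
by have := ler_normD z w; rewrite !normc_def -rmorphD lecR.
Qed.

Lemma cmodB z w : cmod (z - w) <= cmod z + cmod w.
Proof. by rewrite -(cmodN w) cmodD. Qed.

Lemma cmodX z n : cmod (z ^+ n) = cmod z ^+ n.
Proof. by elim: n => [|n IH]; rewrite ?expr0 ?cmod1 // !exprS cmodM IH. Qed.

Lemma cmod_real x : cmod x%:C = `|x|.
Proof. by rewrite /cmod /= expr0n /= addr0 sqrtr_sqr. Qed.

Lemma cmod_nat n : cmod (n%:R : R[i]) = n%:R.
Proof. by rewrite -(rmorph_nat (real_complex R)) cmod_real normr_nat. Qed.

Lemma cmod_i : cmod ('i : R[i]) = 1.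
Proof. by rewrite /cmod /= expr0n expr1n add0r sqrtr1. Qed.

Lemma cmod_eq0 z : (cmod z == 0) = (z == 0).
Proof.
apply/eqP/eqP => [|->]; last exact: cmod0.
by rewrite cmodE; apply: Normc.eq0_normc.
Qed.

Lemma cmod_gt0 z : (0 < cmod z) = (z != 0).
Proof. by rewrite lt_def cmod_ge0 andbT cmod_eq0. Qed.

Lemma cmod_sum (I : Type) (r : seq I) (P : pred I) (F : I -> R[i]) :
  cmod (\sum_(i <- r | P i) F i) <= \sum_(i <- r | P i) cmod (F i).
Proof.
elim/big_rec2: _ => [|i y1 y2 _ le12]; first by rewrite cmod0.
by apply: le_trans (cmodD _ _) _; rewrite lerD2l.
Qed.

Lemma normr_Re_le z : `|complex.Re z| <= cmod z.
Proof.
by rewrite -sqrtr_sqr /cmod ler_sqrt ?addr_ge0 ?sqr_ge0 // lerDl sqr_ge0.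
Qed.

Lemma normr_Im_le z : `|complex.Im z| <= cmod z.
Proof.
by rewrite -sqrtr_sqr /cmod ler_sqrt ?addr_ge0 ?sqr_ge0 // lerDr sqr_ge0.
Qed.

Lemma cmod_le_ReIm z : cmod z <= `|complex.Re z| + `|complex.Im z|.
Proof.
case: z => a b; have -> : a +i* b = a%:C + 'i * b%:C by simpc.
by apply: le_trans (cmodD _ _) _; rewrite cmodM cmod_i mul1r !cmod_real /=; simpc.
Qed.

Definition csums u s := forall e : R, 0 < e ->
  exists N : nat, forall n : nat, (N <= n)%N ->
    cmod (s - \sum_(m < n) u m) < e.

Lemma eq_csums u v s : u =1 v -> csums u s -> csums v s.
Proof.
move=> uv us e /us[N uN]; exists N => n /uN.
by under eq_bigr do rewrite uv.
Qed.

Lemma csums_unique u s t : csums u s -> csums u t -> s = t.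
Proof.
move=> us ut; apply/eqP; rewrite -subr_eq0 -cmod_eq0; apply/negPn/negP => st.
have st0 : 0 < cmod (s - t) / 2 by rewrite divr_gt0 // lt_def st cmod_ge0.
have [N1 h1] := us _ st0; have [N2 h2] := ut _ st0.
have {}h1 := h1 _ (leq_maxl N1 N2); have {}h2 := h2 _ (leq_maxr N1 N2).
set a := \sum_(m < _) _ in h1 h2.
have := cmodB (s - a) (t - a); have -> : s - a - (t - a) = s - t by ring.
by move=> h3; lra.
Qed.

Lemma csumsD u v s t : csums u s -> csums v t ->
  csums (fun m => u m + v m) (s + t).
Proof.
move=> us vt e e0; have e20 : 0 < e / 2 by lra.
have [N1 h1] := us _ e20; have [N2 h2] := vt _ e20.
exists (maxn N1 N2) => n; rewrite geq_max => /andP[/h1 {}h1 /h2 {}h2].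
rewrite big_split /= opprD addrACA.
by apply: le_lt_trans (cmodD _ _) _; lra.
Qed.

Lemma csumsZ a u s : csums u s -> csums (fun m => a * u m) (a * s).
Proof.
move=> us e e0; have a1 : 0 < cmod a + 1 by have := cmod_ge0 a; lra.
have [N h] := us (e / (cmod a + 1)) (divr_gt0 e0 a1).
exists N => n /h; rewrite -mulr_sumr -mulrBr cmodM ltr_pdivlMr // => {}h.
apply: le_lt_trans h; rewrite mulrC ler_wpM2l ?cmod_ge0 //; lra.
Qed.

Lemma csumsB u v s t : csums u s -> csums v t ->
  csums (fun m => u m - v m) (s - t).
Proof.
move=> us /(csumsZ (-1)) vt.
have := csumsD us vt; rewrite mulN1r; apply: eq_csums => m.
by rewrite mulN1r.
Qed.

Lemma csums_shift d u s : (forall m, (m < d)%N -> u m = 0) ->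
  csums (fun m => u (m + d)%N) s -> csums u s.
Proof.
move=> u0 us e /us[N h]; exists (N + d)%N => n Nn.
have dn : (d <= n)%N by apply: leq_trans Nn; apply: leq_addl.
have := h (n - d)%N; rewrite leq_subRL // addnC => /(_ Nn).
suff -> : \sum_(m < n) u m = \sum_(m < n - d) u (m + d)%N by [].
rewrite -(big_mkord predT (fun m => u m)) (@big_cat_nat _ _ _ d) //=.
rewrite big_nat big1 ?add0r => [|i /andP[_ /u0]//].
by rewrite -{1}(add0n d) big_addn big_mkord.
Qed.

Lemma csums_head u : (forall m, (0 < m)%N -> u m = 0) -> csums u (u 0%N).
Proof.
move=> u0 e e0; exists 1%N => -[//|n] _.
by rewrite big_ord_recl big1 ?addr0 ?subrr ?cmod0 // => i _; rewrite u0.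
Qed.

Lemma geometric_sum_le (q : R) (n d : nat) : 0 <= q < 1 ->
  \sum_(n <= m < d) q ^+ m <= q ^+ n / (1 - q).
Proof.
move=> /andP[q0 q1].
have [nd|dn] := leqP n d; last first.
  by rewrite big_geq ?(ltnW dn) // divr_ge0 ?exprn_ge0 // subr_ge0 ltW.
suff -> : \sum_(n <= m < d) q ^+ m = (q ^+ n - q ^+ d) / (1 - q).
  apply: ler_wpM2r; first by rewrite invr_ge0; lra.
  by rewrite gerBl exprn_ge0.
rewrite -(subnKC nd); elim: (d - n)%N => [|k IH].
  by rewrite addn0 big_geq // subrr mul0r.
rewrite addnS big_nat_recr ?leq_addr //= IH exprS.
field; lra.
Qed.

Lemma csums_tail u s (C q : R) : 0 <= q < 1 ->
  (forall m, cmod (u m) <= C * q ^+ m) -> csums u s ->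
  forall n, cmod (s - \sum_(m < n) u m) <= C * (q ^+ n / (1 - q)).
Proof.
move=> q01 uC us n; rewrite leNgt; apply/negP => lt.
have C0 : 0 <= C by have := uC 0%N; rewrite expr0 mulr1; apply/le_trans/cmod_ge0.
(* The excess over the bound serves as the tolerance: a partial sum that close to [s] would break
   the finite geometric estimate. *)
rewrite -subr_gt0 in lt; have [N h] := us _ lt.
have {}h := h _ (leq_maxl N n); have nN := leq_maxr N n.
move: h; set d := maxn N n in nN *; set b := C * _; set sn := \sum_(m < n) _.
set sd := \sum_(m < d) _ => h.
have : cmod (sd - sn) <= b.
  have -> : sd - sn = \sum_(n <= m < d) u m.
    rewrite /sd /sn -!(big_mkord predT (fun m => u m)).
    by rewrite (@big_cat_nat _ _ _ n 0 d) //= addrAC subrr add0r.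
  apply: le_trans (cmod_sum _ _ _) _.
  apply: (@le_trans _ _ (\sum_(n <= m < d) C * q ^+ m)); first exact: ler_sum.
  by rewrite -mulr_sumr ler_wpM2l // geometric_sum_le.
have := cmodD (s - sd) (sd - sn).
have -> : s - sd + (sd - sn) = s - sn by ring.
move=> h1 h2; lra.
Qed.

Lemma csums_le u s (C q : R) : 0 <= q < 1 ->
  (forall m, cmod (u m) <= C * q ^+ m) -> csums u s -> cmod s <= C / (1 - q).
Proof.
move=> q01 uC us; have := csums_tail q01 uC us 0.
by rewrite big_ord0 subr0 expr0 mul1r.
Qed.

Lemma geometric_cvg_lim (v : nat -> R) (C q : R) : 0 <= q < 1 ->
  (forall m, `|v m| <= C * q ^+ m) ->
  exists l : R, forall e : R, 0 < e -> exists N : nat, forall n : nat, (N <= n)%N ->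
    `|l - \sum_(m < n) v m| < e.
Proof.
move=> /andP[q0 q1] vC; have q1' : `|q| < 1 by rewrite ger0_norm.
have cv : cvgn (series v).
  apply: normed_cvg; apply: (series_le_cvg _ _ vC) => [n|n|].
  - exact: normr_ge0.
  - exact: le_trans (normr_ge0 _) (vC n).
  - exact: is_cvg_geometric_series.
exists (limn (series v)) => e e0.
have /cvgrPdist_lt/(_ e e0)[N _ h] := cv.
by exists N => n /h; rewrite /series /= big_mkord.
Qed.

Lemma csums_exists u (C q : R) : 0 <= q < 1 ->
  (forall m, cmod (u m) <= C * q ^+ m) -> exists s, csums u s.
Proof.
move=> q01 uC.
have [a ha] := geometric_cvg_lim q01 (fun m => le_trans (normr_Re_le (u m)) (uC m)).
have [b hb] := geometric_cvg_lim q01 (fun m => le_trans (normr_Im_le (u m)) (uC m)).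
exists (a +i* b) => e e0; have e20 : 0 < e / 2 by lra.
have [N1 h1] := ha _ e20; have [N2 h2] := hb _ e20.
exists (maxn N1 N2) => n; rewrite geq_max => /andP[/h1 {}h1 /h2 {}h2].
apply: le_lt_trans (cmod_le_ReIm _) _.
have -> : a +i* b - \sum_(m < n) u m =
    (a - \sum_(m < n) complex.Re (u m)) +i* (b - \sum_(m < n) complex.Im (u m)).
  have -> : \sum_(m < n) u m =
      (\sum_(m < n) complex.Re (u m)) +i* (\sum_(m < n) complex.Im (u m)).
    elim/big_rec3: _ => [//|i x y z _ ->].
    by case: (u i).
  by [].
by rewrite /=; lra.
Qed.

Lemma csums_term_le u s : csums u s -> exists C, forall m, cmod (u m) <= C.
Proof.
move=> us; have [N h] := us 1 ltr01.
exists (2 + \sum_(i < N) cmod (u i)) => m.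
have S0 : 0 <= \sum_(i < N) cmod (u i) by apply: sumr_ge0 => i _; apply: cmod_ge0.
have [mN|Nm] := ltnP m N.
  rewrite (bigD1 (Ordinal mN)) //= addrCA lerDl addr_ge0 //.
  by apply: sumr_ge0 => i _; apply: cmod_ge0.
have := h _ Nm; have := h _ (leqW Nm); rewrite big_ord_recr /=.
set a := \sum_(i < m) _ => h1 h2.
have := cmodB (s - a) (s - (a + u m)).
have -> : s - a - (s - (a + u m)) = u m by ring.
by move=> h3; lra.
Qed.

(** Near 0 the first non-zero term would dominate all later ones, which are bounded by a geometric
    series of ratio t / t0 since the terms at t0 are bounded. Positive real t suffice, so one real
    ray is enough. *)
Lemma power_series_eq0 (d : nat -> R[i]) (t0 : R) : 0 < t0 ->
  (forall t, 0 < t <= t0 -> csums (fun m => (t ^+ m)%:C * d m) 0) ->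
  forall m, d m = 0.
Proof.
move=> t00 sd.
have [C hC] : exists C, forall m, cmod ((t0 ^+ m)%:C * d m) <= C.
  by apply: csums_term_le (sd t0 _); rewrite t00 lexx.
have C0 : 0 <= C by apply: le_trans (hC 0%N); apply: cmod_ge0.
have dC m : t0 ^+ m * cmod (d m) <= C.
  by have := hC m; rewrite cmodM cmod_real ger0_norm // exprn_ge0 // ltW.
elim/ltn_ind => m IH; apply/eqP; rewrite -cmod_eq0; apply/negPn/negP => dm.
have {}dm : 0 < cmod (d m) by rewrite lt_def dm cmod_ge0.
pose D := t0 ^+ m * cmod (d m).
have D0 : 0 < D by rewrite mulr_gt0 // exprn_gt0.
(* evaluate at t = q * t0 with q so small that the tail cannot cancel the m-th term *)
pose q := D / (2 * C + D + D).
have den0 : 0 < 2 * C + D + D by lra.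
have q0 : 0 < q by apply: divr_gt0.
have q12 : q <= 2^-1 by rewrite /q ler_pdivrMr //; lra.
have qt0 : 0 < q * t0 <= t0.
  by rewrite mulr_gt0 //= -[leRHS]mul1r ler_pM2r //; lra.
have q01 : 0 <= q < 1 by lra.
have uC k : cmod (((q * t0) ^+ k)%:C * d k) <= C * q ^+ k.
  rewrite cmodM cmod_real ger0_norm; last by rewrite exprn_ge0 // ltW //; case/andP: qt0.
  by rewrite exprMn -mulrA mulrC ler_wpM2r // exprn_ge0 // ltW.
have := csums_tail q01 uC (sd _ qt0) m.+1.
rewrite big_ord_recr /= big1 => [|i _]; last by rewrite IH // mulr0.
rewrite !add0r cmodN cmodM cmod_real ger0_norm; last first.
  by rewrite exprn_ge0 // ltW //; case/andP: qt0.
rewrite exprMn -mulrA -/D exprS.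
have qm : 0 < q ^+ m by apply: exprn_gt0.
have -> : C * (q * q ^+ m / (1 - q)) = q ^+ m * (C * q / (1 - q)) by ring.
rewrite ler_pM2l // ler_pdivlMr; last by lra.
have : q * (2 * C + D + D) = D by rewrite /q divfK // lt0r_neq0.
move=> qD h; nra.
Qed.

End ComplexSeries.

(** * Homogeneous forms in two variables and their second-order remainder *)

Section HomogeneousSums.
Variable R : realType.
Implicit Types (c : nat -> nat -> R[i]) (X Y a b : R[i]).

(** [X] and [Y] are independent arguments: the same form is evaluated at the conjugate pair of a
    point, at its real coordinates, and at a node paired with 1. *)
Definition hsum c (m : nat) X Y : R[i] :=
  \sum_(k < m.+1) c k (m - k)%N * (X ^+ k * Y ^+ (m - k)).

(** The differential of the monomial with exponents k, l in the direction [(a, b)]. The truncated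
    predecessors occur only with a zero factor. *)
Definition mlin (k l : nat) X Y a b : R[i] :=
  k%:R * X ^+ k.-1 * Y ^+ l * a + l%:R * X ^+ k * Y ^+ l.-1 * b.

Definition hlin c (m : nat) X Y a b : R[i] :=
  \sum_(k < m.+1) c k (m - k)%N * mlin k (m - k) X Y a b.

Definition d1 c (k l : nat) : R[i] := k.+1%:R * c k.+1 l.
Definition d2 c (k l : nat) : R[i] := l.+1%:R * c k l.+1.

Lemma ord_subnKC (m : nat) (k : 'I_m.+1) : (k + (m - k))%N = m.
Proof. by apply: subnKC; rewrite -ltnS. Qed.

Lemma hsum0 c X Y : hsum c 0 X Y = c 0%N 0%N.
Proof. by rewrite /hsum big_ord1 subnn !expr0 !mulr1. Qed.

Lemma hsum_at0 c m : (0 < m)%N -> hsum c m 0 0 = 0.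
Proof.
move=> m0; apply: big1 => k _; rewrite -exprD ord_subnKC.
by rewrite expr0n; case: m m0 k => // m _ k; rewrite mulr0.
Qed.

Lemma eq_hsum c c' m X Y : (forall k l, (k + l)%N = m -> c k l = c' k l) ->
  hsum c m X Y = hsum c' m X Y.
Proof.
move=> cc'; apply: eq_bigr => k _; by rewrite cc' // ord_subnKC.
Qed.

Lemma hsumD c c' m X Y :
  hsum (fun k l => c k l + c' k l) m X Y = hsum c m X Y + hsum c' m X Y.
Proof. by rewrite /hsum -big_split; apply: eq_bigr => k _; rewrite mulrDl. Qed.

Lemma hsumZ s c m X Y :
  hsum (fun k l => s * c k l) m X Y = s * hsum c m X Y.
Proof. by rewrite /hsum mulr_sumr; apply: eq_bigr => k _; rewrite -mulrA. Qed.

Lemma hsumB c c' m X Y :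
  hsum (fun k l => c k l - c' k l) m X Y = hsum c m X Y - hsum c' m X Y.
Proof. by rewrite /hsum -sumrB; apply: eq_bigr => k _; rewrite mulrBl. Qed.

Lemma hsum_scale c m s X Y : hsum c m (s * X) (s * Y) = s ^+ m * hsum c m X Y.
Proof.
rewrite /hsum mulr_sumr; apply: eq_bigr => k _.
have -> : s ^+ m = s ^+ k * s ^+ (m - k).
  by rewrite -exprD ord_subnKC.
rewrite !exprMn; ring.
Qed.

Lemma hlin0 c X Y a b : hlin c 0 X Y a b = 0.
Proof. by rewrite /hlin big_ord1 subnn /mlin !mul0r addr0 mulr0. Qed.

Lemma hlinS c m X Y a b :
  hlin c m.+1 X Y a b = a * hsum (d1 c) m X Y + b * hsum (d2 c) m X Y.
Proof.
rewrite /hlin; under eq_bigr do rewrite /mlin mulrDr.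
rewrite big_split /=; congr (_ + _).
  rewrite big_ord_recl /= !mul0r mulr0 add0r mulr_sumr.
  by apply: eq_bigr => k _; rewrite /d1 /bump /= ?add1n subSS; ring.
rewrite big_ord_recr /= subnn !mul0r mulr0 addr0 mulr_sumr.
apply: eq_bigr => k _; rewrite subSn; last by rewrite -ltnS.
rewrite /d2 /=; ring.
Qed.

Lemma hlin_euler c m X Y : hlin c m X Y X Y = m%:R * hsum c m X Y.
Proof.
rewrite /hlin /hsum mulr_sumr; apply: eq_bigr => k _.
have -> : m%:R = k%:R + (m - k)%:R :> R[i] by rewrite -natrD ord_subnKC.
have e n (Z : R[i]) : n%:R * Z ^+ n = n%:R * Z ^+ n.-1 * Z.
  by case: n => [|n]; rewrite ?mul0r // exprSr mulrA.
have -> : mlin k (m - k) X Y X Y =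
  k%:R * X ^+ k * Y ^+ (m - k) + X ^+ k * ((m - k)%:R * Y ^+ (m - k)).
  by rewrite e (e (m - k)%N) /mlin; ring.
ring.
Qed.

Lemma mlinSl k l X Y a b :
  mlin k.+1 l X Y a b = X * mlin k l X Y a b + a * (X ^+ k * Y ^+ l).
Proof.
rewrite /mlin /= exprS -natr1.
by case: k => [|k] /=; rewrite ?exprS; ring.
Qed.

Lemma mlinSr k l X Y a b :
  mlin k l.+1 X Y a b = Y * mlin k l X Y a b + b * (X ^+ k * Y ^+ l).
Proof.
rewrite /mlin /= exprS -natr1.
by case: l => [|l] /=; rewrite ?exprS; ring.
Qed.

Lemma cmod_monomial_le (rho : R) k l X Y : cmod X <= rho -> cmod Y <= rho ->
  cmod (X ^+ k * Y ^+ l) <= rho ^+ (k + l).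
Proof.
move=> hX hY; rewrite cmodM !cmodX exprD ler_pM ?exprn_ge0 ?cmod_ge0 //.
  by rewrite lerXn2r // ?nnegrE ?cmod_ge0 // (le_trans (cmod_ge0 X)).
by rewrite lerXn2r // ?nnegrE ?cmod_ge0 // (le_trans (cmod_ge0 Y)).
Qed.

(** Induction on the exponents by the product rules [mlinSl] and [mlinSr]. The factor [rho] on the
    left stands in for the exponent k + l - 1, which would be truncated in degree 0. *)
Lemma mlin_le (rho d : R) k l X Y a b : cmod X <= rho -> cmod Y <= rho ->
  cmod a <= d -> cmod b <= d ->
  cmod (mlin k l X Y a b) * rho <= d * (k + l)%:R * rho ^+ (k + l).
Proof.
move=> hX hY ha hb.
have r0 : 0 <= rho := le_trans (cmod_ge0 X) hX.
have step (n : nat) Z s (M w : R[i]) : cmod Z <= rho -> cmod s <= d ->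
    cmod w <= rho ^+ n -> cmod M * rho <= d * n%:R * rho ^+ n ->
    cmod (Z * M + s * w) * rho <= d * n.+1%:R * rho ^+ n.+1.
  move=> hZ hs hw hM.
  have := cmodD (Z * M) (s * w); rewrite !cmodM => h.
  apply: le_trans (ler_wpM2r r0 h) _.
  have -> : d * n.+1%:R * rho ^+ n.+1 =
    rho * (d * n%:R * rho ^+ n) + d * rho ^+ n * rho by rewrite exprS -natr1; ring.
  rewrite mulrDl; apply: lerD.
    rewrite -[leLHS]mulrA; apply: ler_pM => //; first exact: cmod_ge0.
    by rewrite mulr_ge0 ?cmod_ge0.
  by apply: ler_wpM2r => //; apply: ler_pM; rewrite ?cmod_ge0.
elim: k => [|k IH].
  elim: l => [|l IH]; first by rewrite /mlin !mul0r addr0 cmod0 mul0r mulr0 mul0r.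
  by rewrite mlinSr addnS; apply: step => //; apply: cmod_monomial_le.
by rewrite mlinSl addSn; apply: step => //; apply: cmod_monomial_le.
Qed.

(** Multiplying the monomial by X turns the remainder E into (X + a) E + a M, with M the
    differential bounded by [mlin_le], and likewise for Y; the bound closes because n^2 + n is at
    most (n + 1)^2. *)
Lemma monomial_remainder_le (rho d : R) k l X Y a b : 0 < rho ->
  cmod X <= rho -> cmod Y <= rho ->
  cmod (X + a) <= rho -> cmod (Y + b) <= rho -> cmod a <= d -> cmod b <= d ->
  cmod ((X + a) ^+ k * (Y + b) ^+ l - X ^+ k * Y ^+ l - mlin k l X Y a b) * rho ^+ 2
    <= d ^+ 2 * (k + l)%:R ^+ 2 * rho ^+ (k + l).
Proof.
move=> r0 hX hY hXa hYb ha hb.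
have d0 : 0 <= d := le_trans (cmod_ge0 a) ha.
have step (n : nat) Z s (E M : R[i]) : cmod Z <= rho -> cmod s <= d ->
    cmod M * rho <= d * n%:R * rho ^+ n ->
    cmod E * rho ^+ 2 <= d ^+ 2 * n%:R ^+ 2 * rho ^+ n ->
    cmod (Z * E + s * M) * rho ^+ 2 <= d ^+ 2 * n.+1%:R ^+ 2 * rho ^+ n.+1.
  move=> hZ hs hM hE.
  have := cmodD (Z * E) (s * M); rewrite !cmodM => h.
  apply: le_trans (ler_wpM2r (exprn_ge0 2 (ltW r0)) h) _.
  have n0 : 0 <= n%:R :> R by apply: ler0n.
  have rn : 0 <= rho ^+ n.+1 by rewrite exprn_ge0 // ltW.
  apply: (@le_trans _ _ (rho * (d ^+ 2 * n%:R ^+ 2 * rho ^+ n) + d * (d * n%:R * rho ^+ n) * rho)).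
    rewrite mulrDl; apply: lerD.
      rewrite -[leLHS]mulrA; apply: ler_pM => //; first exact: cmod_ge0.
      by rewrite mulr_ge0 ?cmod_ge0 ?exprn_ge0 // ltW.
    rewrite expr2 mulrA ler_wpM2r ?(ltW r0) // -[leLHS]mulrA.
    apply: ler_pM => //; first exact: cmod_ge0.
    by rewrite mulr_ge0 ?cmod_ge0 // ltW.
  have -> : rho * (d ^+ 2 * n%:R ^+ 2 * rho ^+ n) + d * (d * n%:R * rho ^+ n) * rho =
    d ^+ 2 * (n%:R ^+ 2 + n%:R) * rho ^+ n.+1 by rewrite (exprS rho n); ring.
  rewrite ler_wpM2r // ler_wpM2l ?exprn_ge0 // -natr1; nra.
elim: k => [|k IH].
  elim: l => [|l IH].
    by rewrite /mlin !mul0r addr0 !expr0 !subrr cmod0 mul0r expr0n mulr0 mul0r.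
  rewrite mlinSr addnS.
  have -> : (X + a) ^+ 0 * (Y + b) ^+ l.+1 - X ^+ 0 * Y ^+ l.+1 -
      (Y * mlin 0 l X Y a b + b * (X ^+ 0 * Y ^+ l)) =
    (Y + b) * ((X + a) ^+ 0 * (Y + b) ^+ l - X ^+ 0 * Y ^+ l - mlin 0 l X Y a b)
    + b * mlin 0 l X Y a b by rewrite !exprS; ring.
  by apply: step => //; apply: mlin_le.
rewrite mlinSl addSn.
have -> : (X + a) ^+ k.+1 * (Y + b) ^+ l - X ^+ k.+1 * Y ^+ l -
    (X * mlin k l X Y a b + a * (X ^+ k * Y ^+ l)) =
  (X + a) * ((X + a) ^+ k * (Y + b) ^+ l - X ^+ k * Y ^+ l - mlin k l X Y a b)
  + a * mlin k l X Y a b by rewrite !exprS; ring.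
by apply: step => //; apply: mlin_le.
Qed.

Lemma hsum_remainder_le c m (rho d : R) X Y a b : 0 < rho ->
  cmod X <= rho -> cmod Y <= rho ->
  cmod (X + a) <= rho -> cmod (Y + b) <= rho -> cmod a <= d -> cmod b <= d ->
  cmod (hsum c m (X + a) (Y + b) - hsum c m X Y - hlin c m X Y a b) * rho ^+ 2
    <= d ^+ 2 * ((\sum_(k < m.+1) cmod (c k (m - k)%N)) * m.+1%:R ^+ 2 * rho ^+ m).
Proof.
move=> r0 hX hY hXa hYb ha hb.
rewrite /hsum /hlin -!sumrB.
apply: (@le_trans _ _ (\sum_(k < m.+1) cmod (c k (m - k)%N) * (d ^+ 2 * m%:R ^+ 2 * rho ^+ m))).
  apply: le_trans (ler_wpM2r (exprn_ge0 2 (ltW r0)) (cmod_sum _ _ _)) _.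
  rewrite mulr_suml; apply: ler_sum => k _.
  rewrite -!mulrBr cmodM -[leLHS]mulrA ler_wpM2l ?cmod_ge0 //.
  have km := ord_subnKC k.
  rewrite -[in X in _ <= X]km; exact: monomial_remainder_le.
rewrite -mulr_suml; set S := \sum_(k < _) _.
have S0 : 0 <= S by apply: sumr_ge0 => k _; apply: cmod_ge0.
have -> : d ^+ 2 * (S * m.+1%:R ^+ 2 * rho ^+ m) = S * (d ^+ 2 * m.+1%:R ^+ 2 * rho ^+ m).
  by ring.
rewrite ler_wpM2l // ler_wpM2r ?exprn_ge0 ?(ltW r0) // ler_wpM2l ?sqr_ge0 //.
by rewrite lerXn2r // ?nnegrE ?ler0n // ler_nat.
Qed.

Lemma hsum_le c m (rho : R) X Y : cmod X <= rho -> cmod Y <= rho ->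
  cmod (hsum c m X Y) <= (\sum_(k < m.+1) cmod (c k (m - k)%N)) * rho ^+ m.
Proof.
move=> hX hY; apply: le_trans (cmod_sum _ _ _) _.
rewrite mulr_suml; apply: ler_sum => k _.
rewrite cmodM ler_wpM2l ?cmod_ge0 //.
have km := ord_subnKC k.
by rewrite -[in X in _ <= X]km; apply: cmod_monomial_le.
Qed.

End HomogeneousSums.

(** * Coefficient growth and its stability under polynomial factors *)

Section Growth.
Variable R : realType.
Implicit Types (r : \bar R) (c : nat -> nat -> R[i]).

Definition growth r c := forall rho : R, 0 < rho -> (rho%:E < r)%E ->
  exists C, forall k l, cmod (c k l) * rho ^+ (k + l) <= C.

(** For one more power, q is split as p (q / p) with p the midpoint of q and 1: one factor carries
    the inductive bound and the other absorbs the new power. *)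
Lemma poly_geometric_le j (q : R) : 0 <= q < 1 ->
  exists C, forall N, N.+1%:R ^+ j * q ^+ N <= C.
Proof.
elim: j q => [|j IH] q q01.
  by exists 1 => N; rewrite mul1r; apply: exprn_ile1; lra.
(* Each of the N + 1 terms p^i with i <= N is at least p^N, so the left side is below the full
   geometric sum. *)
have one (p : R) N : 0 <= p < 1 -> N.+1%:R * p ^+ N <= 1 / (1 - p).
  move=> p01; have := geometric_sum_le 0 N.+1 p01; rewrite expr0; apply: le_trans.
  rewrite mulr_natl -{1}(card_ord N.+1) -sumr_const big_mkord.
  apply: ler_sum => i _; apply: ler_wiXn2l => //; try lra.
  by rewrite -ltnS.
pose p := (q + 1) / 2.
have p01 : 0 < p < 1 by rewrite /p; lra.
have [C hC] := IH p ltac:(lra).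
have qp : 0 <= q / p < 1.
  rewrite divr_ge0 /=; [|lra|lra]. rewrite ltr_pdivrMr; rewrite /p; lra.
exists (C * (1 / (1 - q / p))) => N.
have -> : N.+1%:R ^+ j.+1 * q ^+ N = (N.+1%:R ^+ j * p ^+ N) * (N.+1%:R * (q / p) ^+ N).
  have -> : q ^+ N = p ^+ N * (q / p) ^+ N.
    by rewrite -exprMn mulrC divfK //; apply: lt0r_neq0; lra.
  by rewrite (exprS _ j); ring.
apply: ler_pM; rewrite ?mulr_ge0 ?exprn_ge0 ?ler0n //; [lra|lra|exact: one].
Qed.

Lemma ereal_between (x : R) r : (x%:E < r)%E -> exists2 y : R, x < y & (y%:E < r)%E.
Proof.
case: r => [s||] //=.
  by rewrite lte_fin => xs; exists ((x + s) / 2); rewrite ?lte_fin; lra.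
by move=> _; exists (x + 1); rewrite ?ltry //; lra.
Qed.

(** A radius rho' strictly between rho and r gives the ratio rho / rho' < 1, which is split in two:
    one factor swallows the polynomial weight, the other remains as geometric decay. *)
Lemma growth_geometric r c (j : nat) (rho : R) : growth r c -> 0 < rho ->
  (rho%:E < r)%E ->
  exists C q : R, [/\ 0 <= q < 1, 0 <= C & forall k l,
    cmod (c k l) * (k + l).+1%:R ^+ j * rho ^+ (k + l) <= C * q ^+ (k + l)].
Proof.
move=> gc r0 /ereal_between[rho' rr' /gc[|C hC]]; first lra.
pose q0 := rho / rho'; pose q := (q0 + 1) / 2.
have q00 : 0 < q0 < 1.
  rewrite divr_gt0 //=; [|lra]. by rewrite ltr_pdivrMr; lra.
have q01 : 0 < q < 1 by rewrite /q; lra.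
have qq : 0 <= q0 / q < 1.
  rewrite divr_ge0 /=; [|lra|lra]. by rewrite ltr_pdivrMr; rewrite /q; lra.
have [C' hC'] := poly_geometric_le j qq.
have C0 : 0 <= C.
  by apply: le_trans (hC 0%N 0%N); rewrite mulr_ge0 ?cmod_ge0 ?exprn_ge0 //; lra.
have C'0 : 0 <= C'.
  apply: le_trans (hC' 0%N); rewrite mulr_ge0 ?exprn_ge0 //; lra.
exists (C * C'), q; split; [lra|exact: mulr_ge0|move=> k l].
set N := (k + l)%N.
have -> : cmod (c k l) * N.+1%:R ^+ j * rho ^+ N =
   (cmod (c k l) * rho' ^+ N) * ((N.+1%:R ^+ j * (q0 / q) ^+ N) * q ^+ N).
  have e1 : rho = rho' * q0 by rewrite /q0 mulrC divfK //; lra.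
  have e2 : q0 ^+ N = (q0 / q) ^+ N * q ^+ N by rewrite -exprMn divfK //; lra.
  by rewrite e1 exprMn e2; ring.
rewrite -[leRHS]mulrA; apply: ler_pM => //.
- by rewrite mulr_ge0 ?cmod_ge0 ?exprn_ge0 //; lra.
- by rewrite !mulr_ge0 ?exprn_ge0 ?ler0n //; lra.
- by rewrite ler_wpM2r // exprn_ge0 //; lra.
Qed.

(** A polynomial loss is absorbed by a slightly larger radius. Differentiation, the boundary systems
    and the division by [Pa] rely on this. *)
Lemma growth_poly (j : nat) r c :
  (forall rho : R, 0 < rho -> (rho%:E < r)%E ->
    exists C, forall k l, cmod (c k l) * rho ^+ (k + l) <= C * (k + l).+1%:R ^+ j) ->
  growth r c.
Proof.
move=> gc rho r0 /ereal_between[rho' rr' /gc[|C hC]]; first lra.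
have q0 : 0 <= rho / rho' < 1.
  rewrite divr_ge0 /=; [|lra|lra]. by rewrite ltr_pdivrMr; lra.
have [C' hC'] := poly_geometric_le j q0.
have C0 : 0 <= C.
  have := hC 0%N 0%N; rewrite expr1n mulr1; apply: le_trans.
  by rewrite mulr_ge0 ?cmod_ge0 ?exprn_ge0 //; lra.
exists (C * C') => k l; set N := (k + l)%N.
apply: (@le_trans _ _ (C * N.+1%:R ^+ j * (rho / rho') ^+ N)); last first.
  by rewrite -mulrA ler_wpM2l.
have -> : cmod (c k l) * rho ^+ N = cmod (c k l) * rho' ^+ N * (rho / rho') ^+ N.
  by rewrite -mulrA -exprMn mulrCA divff ?mulr1 //; lra.
by rewrite ler_wpM2r // exprn_ge0 //; lra.
Qed.

(** A block of degree m has m + 1 terms, so the coefficientwise estimate is used with one extra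
    power of m + 1. *)
Lemma growth_sum r c (j : nat) (rho : R) : growth r c -> 0 < rho ->
  (rho%:E < r)%E ->
  exists C q : R, [/\ 0 <= q < 1, 0 <= C & forall m,
    (\sum_(k < m.+1) cmod (c k (m - k)%N)) * m.+1%:R ^+ j * rho ^+ m <= C * q ^+ m].
Proof.
move=> gc r0 /(growth_geometric j.+1 gc r0)[C [q [q01 C0 hC]]].
exists C, q; split => // m.
rewrite -mulrA mulr_suml -[leRHS]mul1r.
have e1 : 1 = \sum_(k < m.+1) m.+1%:R^-1 :> R.
  by rewrite sumr_const card_ord -[RHS]mulr_natr mulVf.
rewrite [X in _ <= X * _]e1 mulr_suml; apply: ler_sum => k _.
have km := ord_subnKC k.
rewrite ler_pdivlMl ?ltr0n //.
have := hC k (m - k)%N; rewrite km; apply: le_trans.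
by rewrite [in leRHS]exprS le_eqVlt; apply/orP; left; apply/eqP; ring.
Qed.

Lemma growth_sub r r' c : (r <= r')%E -> growth r' c -> growth r c.
Proof. by move=> rr' gc rho r0 rr; apply: gc => //; apply: lt_le_trans rr'. Qed.

Lemma growthD r c c' : growth r c -> growth r c' ->
  growth r (fun k l => c k l + c' k l).
Proof.
move=> gc gc' rho r0 rr; have [C hC] := gc _ r0 rr; have [C' hC'] := gc' _ r0 rr.
exists (C + C') => k l; apply: le_trans (lerD (hC k l) (hC' k l)).
by rewrite -mulrDl ler_wpM2r ?cmodD // exprn_ge0 // ltW.
Qed.

Lemma growthZ r s c : growth r c -> growth r (fun k l => s * c k l).
Proof.
move=> gc rho r0 rr; have [C hC] := gc _ r0 rr.
exists (cmod s * C) => k l; rewrite cmodM -mulrA.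
by rewrite ler_wpM2l ?cmod_ge0.
Qed.

Lemma growthB r c c' : growth r c -> growth r c' ->
  growth r (fun k l => c k l - c' k l).
Proof.
move=> gc /(growthZ (-1)) gc'; move: (growthD gc gc') => g rho r0 rr.
have [C hC] := g _ r0 rr.
by exists C => k l; have := hC k l; rewrite mulN1r.
Qed.

Lemma growth_d1 r c : growth r c -> growth r (d1 c).
Proof.
move=> gc; apply: (@growth_poly 1) => rho r0 rr; have [C hC] := gc _ r0 rr.
exists (C / rho) => k l; rewrite /d1 cmodM cmod_nat.
have C0 : 0 <= C by apply: le_trans (hC 0%N 0%N); rewrite mulr_ge0 ?cmod_ge0 ?exprn_ge0 ?ltW.
have := hC k.+1 l; rewrite addSn exprS => h.
rewrite expr1 [leRHS]mulrAC ler_pdivlMr //.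
have -> : k.+1%:R * cmod (c k.+1 l) * rho ^+ (k + l) * rho =
  k.+1%:R * (cmod (c k.+1 l) * (rho * rho ^+ (k + l))) by ring.
rewrite [leLHS]mulrC; apply: ler_pM => //.
  by rewrite !mulr_ge0 ?cmod_ge0 ?exprn_ge0 // ltW.
by rewrite ler_nat ltnS leq_addr.
Qed.

Lemma growth_d2 r c : growth r c -> growth r (d2 c).
Proof.
move=> gc.
have : growth r (d1 (fun k l => c l k)).
  apply: growth_d1 => rho r0 rr; have [C hC] := gc _ r0 rr.
  by exists C => k l; rewrite addnC.
move=> g rho r0 rr; have [C hC] := g _ r0 rr.
by exists C => k l; rewrite addnC; apply: hC.
Qed.

End Growth.

(** * Functions represented by series; termwise differentiation *)

Section SeriesRepresentation.
Variable R : realType.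
Implicit Types (r : \bar R) (c : nat -> nat -> R[i]) (f : R * R -> R[i]) (z h : R * R).

Definition zc z : R[i] := z.1 +i* z.2.
Definition zcc z : R[i] := z.1 -i* z.2.

Lemma zcE z : zc z = z.1%:C + 'i * z.2%:C.
Proof. by rewrite /zc; simpc. Qed.

Lemma zccE z : zcc z = z.1%:C - 'i * z.2%:C.
Proof. by rewrite /zcc; simpc. Qed.

(** Summation is by homogeneous blocks, as in [Aan], and the values of [f] outside the disc are
    unconstrained; [growth] controls the individual coefficients. *)
Definition has_series r f c := growth r c /\
  forall z, disc r z -> csums (fun m => hsum c m (zc z) (zcc z)) (f z).

Lemma cmod_zcc z : cmod (zcc z) = cmod (zc z).
Proof. by rewrite /cmod /= sqrrN. Qed.

Lemma disc_radius r z : disc r z ->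
  exists rho : R, [/\ 0 < rho, cmod (zc z) < rho & (rho%:E < r)%E].
Proof.
move=> /ereal_between[rho zr rr]; exists rho; split => //.
exact: le_lt_trans (cmod_ge0 (zc z)) zr.
Qed.

Lemma hsum_geometric r c (rho : R) : growth r c -> 0 < rho -> (rho%:E < r)%E ->
  exists C q : R, [/\ 0 <= q < 1, 0 <= C & forall m z, cmod (zc z) <= rho ->
    cmod (hsum c m (zc z) (zcc z)) <= C * q ^+ m].
Proof.
move=> gc r0 /(growth_sum 0 gc r0)[C [q [q01 C0 hC]]]; exists C, q; split => // m z zr.
apply: le_trans (hC m); rewrite expr0 mulr1.
by apply: hsum_le; rewrite ?cmod_zcc.
Qed.

Lemma hsum_summable r c z : growth r c -> disc r z ->
  exists s, csums (fun m => hsum c m (zc z) (zcc z)) s.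
Proof.
move=> gc /disc_radius[rho [r0 zr rr]].
have [C [q [q01 C0 hC]]] := hsum_geometric gc r0 rr.
by apply: (csums_exists q01 (fun m => hC m z (ltW zr))).
Qed.

(** [s1] and [s2] are the derivatives of [f] in zeta and zeta'. The second-order remainders of the
    blocks are bounded by |h|^2 times a geometric series, uniformly while z + h stays in a disc of
    radius rho < r. *)
Lemma series_expansion r f c z : has_series r f c -> disc r z ->
  exists C d s1 s2, [/\ 0 <= C, 0 < d,
    csums (fun m => hsum (d1 c) m (zc z) (zcc z)) s1,
    csums (fun m => hsum (d2 c) m (zc z) (zcc z)) s2 &
    forall h, cmod (zc h) <= d ->
    cmod (f (z.1 + h.1, z.2 + h.2) - f z - (zc h * s1 + zcc h * s2))
      <= C * cmod (zc h) ^+ 2].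
Proof.
move=> [gc fc] dz; have [rho [r0 zr rr]] := disc_radius dz.
have [s1 h1] := hsum_summable (growth_d1 gc) dz.
have [s2 h2] := hsum_summable (growth_d2 gc) dz.
have [C [q [q01 C0 hC]]] := growth_sum 2 gc r0 rr.
exists (C / rho ^+ 2 / (1 - q)), (rho - cmod (zc z)), s1, s2; split => //.
- by rewrite !divr_ge0 ?exprn_ge0 // ?(ltW r0) //; lra.
- lra.
move=> h hd.
have ezc : zc (z.1 + h.1, z.2 + h.2) = zc z + zc h by [].
have ezcc : zcc (z.1 + h.1, z.2 + h.2) = zcc z + zcc h by rewrite /zcc opprD.
have zhr : cmod (zc z + zc h) <= rho by apply: le_trans (cmodD _ _) _; lra.
have zh : disc r (z.1 + h.1, z.2 + h.2).
  by apply: le_lt_trans rr; rewrite lee_fin.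
have hl : csums (fun m => hlin c m (zc z) (zcc z) (zc h) (zcc h)) (zc h * s1 + zcc h * s2).
  (* The differential of the constant block is zero, so the series of differentials starts one
     degree later. *)
  apply: (@csums_shift _ 1) => [[|m]//|]; first by rewrite hlin0.
  apply: eq_csums (csumsD (csumsZ (zc h) h1) (csumsZ (zcc h) h2)) => m.
  by rewrite addn1 hlinS.
have := csumsB (csumsB (fc _ zh) (fc _ dz)) hl.
rewrite ezc ezcc => hs.
have -> : C / rho ^+ 2 / (1 - q) * cmod (zc h) ^+ 2 = (cmod (zc h) ^+ 2 * C / rho ^+ 2) / (1 - q).
  by ring.
apply: (csums_le q01 _ hs) => m.
have -> : cmod (zc h) ^+ 2 * C / rho ^+ 2 * q ^+ m = cmod (zc h) ^+ 2 * (C * q ^+ m) / rho ^+ 2.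
  by ring.
rewrite ler_pdivlMr ?exprn_gt0 //.
apply: le_trans (ler_wpM2l (sqr_ge0 _) (hC m)).
apply: hsum_remainder_le; rewrite ?cmod_zcc ?(ltW zr) // -ezcc cmod_zcc.
by rewrite ezc.
Qed.

Lemma derive_of_quadratic (F : R -> R) (x L C d : R) : 0 < d ->
  (forall t, `|t| <= d -> `|F (x + t) - F x - t * L| <= C * t ^+ 2) ->
  derivable F x 1 /\ derive1 F x = L.
Proof.
move=> d0 hF.
have C0 : 0 <= C.
  have := hF d; rewrite gtr0_norm // => /(_ (lexx d))/(le_trans (normr_ge0 _)).
  by rewrite pmulr_lge0 // exprn_gt0.
have lim : h^-1 *: (F (h + x) - F x) @[h --> 0^'] --> L.
  apply/cvgrPdist_le => e e0; near=> h.
  have h0 : h != 0 by near: h; exact: nbhs_dnbhs_neq.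
  have hd : `|h| < Num.min d (e / (C + 1)).
    near: h; apply: dnbhs0_lt; rewrite lt_min d0 divr_gt0 //; lra.
  move: hd; rewrite lt_min => /andP[hd he].
  have -> : L - h^-1 *: (F (h + x) - F x) = - ((F (x + h) - F x - h * L) / h).
    by rewrite (addrC h) /GRing.scale /=; field.
  rewrite normrN normrM normrV ?unitfE // ler_pdivrMr ?normr_gt0 //.
  apply: le_trans (hF _ (ltW hd)) _.
  rewrite -[h ^+ 2]real_normK ?num_real // expr2 mulrA ler_wpM2r //.
  move: he; rewrite ltr_pdivlMr; last by lra.
  have := normr_ge0 h; nra.
split; last by rewrite /derive1; apply: cvg_lim.
apply: cvgP; rewrite /=.
under eq_fun do rewrite /shift /= /GRing.scale /= mulr1.
exact: lim.
Unshelve. all: by end_near.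
Qed.

(* [d/dx = d/dzeta + d/dzeta'] and [d/dy = i (d/dzeta - d/dzeta')] on coefficient families. *)
Definition Dx c (k l : nat) : R[i] := d1 c k l + d2 c k l.
Definition Dy c (k l : nat) : R[i] := 'i * (d1 c k l - d2 c k l).

Lemma growth_Dx r c : growth r c -> growth r (Dx c).
Proof. by move=> gc; apply: growthD; [exact: growth_d1|exact: growth_d2]. Qed.

Lemma growth_Dy r c : growth r c -> growth r (Dy c).
Proof.
by move=> gc; apply/growthZ/growthB; [exact: growth_d1|exact: growth_d2].
Qed.

(** The increments of (zeta, zeta') are (t, t) in the x-direction and (i t, - i t) in the
    y-direction, so one complex expansion gives all four real derivatives. *)
Lemma series_dx_dy r f c z : has_series r f c -> disc r z ->
  [/\ derivable (fun t => complex.Re (f (t, z.2))) z.1 1,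
      derivable (fun t => complex.Im (f (t, z.2))) z.1 1,
      derivable (fun t => complex.Re (f (z.1, t))) z.2 1 &
      derivable (fun t => complex.Im (f (z.1, t))) z.2 1] /\
  csums (fun m => hsum (Dx c) m (zc z) (zcc z)) (dx f z) /\
  csums (fun m => hsum (Dy c) m (zc z) (zcc z)) (dy f z).
Proof.
move=> sf dz; have [C [d [s1 [s2 [C0 d0 h1 h2 hf]]]]] := series_expansion sf dz.
have hx t : `|t| <= d ->
    cmod (f (z.1 + t, z.2) - f z - t%:C * (s1 + s2)) <= C * t ^+ 2.
  move=> td; have := hf (t, 0); rewrite /= addr0.
  have -> : zc (t, 0) = t%:C by [].
  have -> : zcc (t, 0) = t%:C by rewrite /zcc /= oppr0.
  by rewrite cmod_real mulrDr real_normK ?num_real //; apply.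
have hy t : `|t| <= d ->
    cmod (f (z.1, z.2 + t) - f z - t%:C * ('i * (s1 - s2))) <= C * t ^+ 2.
  move=> td; have := hf (0, t); rewrite /= addr0.
  have -> : zc (0, t) = t%:C * 'i by rewrite /zc /=; simpc.
  have -> : zcc (0, t) = - (t%:C * 'i) by rewrite /zcc /=; simpc.
  rewrite cmodM cmod_i mulr1 cmod_real real_normK ?num_real //.
  have -> : t%:C * 'i * s1 + - (t%:C * 'i) * s2 = t%:C * ('i * (s1 - s2)) by ring.
  exact.
have re (g : R -> R[i]) (x : R) L : (forall t, `|t| <= d -> cmod (g (x + t) - g x - t%:C * L) <= C * t ^+ 2) ->
    derivable (fun t => complex.Re (g t)) x 1 /\ derive1 (fun t => complex.Re (g t)) x = complex.Re L.
  move=> hg; apply: (derive_of_quadratic (C := C) d0) => t /hg; apply: le_trans.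
  apply: le_trans (normr_Re_le _); rewrite !raddfB /=.
  by case: L {hg} => a b /=; rewrite mul0r subr0.
have im (g : R -> R[i]) (x : R) L : (forall t, `|t| <= d -> cmod (g (x + t) - g x - t%:C * L) <= C * t ^+ 2) ->
    derivable (fun t => complex.Im (g t)) x 1 /\ derive1 (fun t => complex.Im (g t)) x = complex.Im L.
  move=> hg; apply: (derive_of_quadratic (C := C) d0) => t /hg; apply: le_trans.
  apply: le_trans (normr_Im_le _); rewrite !raddfB /=.
  by case: L {hg} => a b /=; rewrite mul0r addr0.
have ez : f z = f (z.1, z.2) by case: (z).
rewrite ez in hx hy.
have [d_1 e1] := re (fun t => f (t, z.2)) _ _ hx.
have [d_2 e2] := im (fun t => f (t, z.2)) _ _ hx.
have [d_3 e3] := re (fun t => f (z.1, t)) _ _ hy.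
have [d_4 e4] := im (fun t => f (z.1, t)) _ _ hy.
split; first exact: And4 d_1 d_2 d_3 d_4.
have eta (w : R[i]) : complex.Re w +i* complex.Im w = w by case: w.
rewrite /dx e1 e2 eta /dy e3 e4 eta; split.
  by apply: eq_csums (csumsD h1 h2) => m; rewrite -hsumD.
by apply: eq_csums (csumsZ 'i (csumsB h1 h2)) => m; rewrite -hsumB -hsumZ.
Qed.

Lemma series_dx r f c : has_series r f c -> has_series r (dx f) (Dx c).
Proof.
move=> sf; split=> [|z dz]; first exact/growth_Dx/sf.1.
by have [_ []] := series_dx_dy sf dz.
Qed.

Lemma series_dy r f c : has_series r f c -> has_series r (dy f) (Dy c).
Proof.
move=> sf; split=> [|z dz]; first exact/growth_Dy/sf.1.
by have [_ []] := series_dx_dy sf dz.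
Qed.

Lemma series_continuous r f c z : has_series r f c -> disc r z ->
  {for z, continuous (fun w : R * R => complex.Re (f w))} /\
  {for z, continuous (fun w : R * R => complex.Im (f w))}.
Proof.
move=> sf dz; have [C [d [s1 [s2 [C0 d0 h1 h2 hf]]]]] := series_expansion sf dz.
have near_f (e : R) : 0 < e -> \forall w \near z, cmod (f z - f w) <= e.
  move=> e0; pose K := C * d + cmod s1 + cmod s2 + 1.
  have K0 : 0 < K.
    by rewrite /K; have := cmod_ge0 s1; have := cmod_ge0 s2; have := mulr_ge0 C0 (ltW d0); lra.
  (* Halved because |h| is bounded by the sum of its two coordinate increments; [K] is a Lipschitz
     constant valid for |h| <= d. *)
  pose a := Num.min (d / 2) (e / K / 2).
  have a0 : 0 < a by rewrite lt_min !divr_gt0.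
  near=> w.
  have [/= w1 w2] : ball z a w by near: w; exact: nbhsx_ballx.
  pose h := (w.1 - z.1, w.2 - z.2).
  have zh : cmod (zc h) <= a + a.
    apply: le_trans (cmod_le_ReIm _) _; rewrite /=.
    by apply: lerD; rewrite distrC ltW.
  have [ad aK] : a <= d / 2 /\ a <= e / K / 2.
    by rewrite /a; split; rewrite ge_min lexx ?orbT.
  have hd : cmod (zc h) <= d by lra.
  have he : cmod (zc h) * K <= e by rewrite -ler_pdivlMr //; lra.
  have := hf h hd; rewrite /= !subrKC -surjective_pairing.
  set l := zc h * s1 + zcc h * s2 => hw.
  have hl : cmod l <= cmod (zc h) * (cmod s1 + cmod s2).
    by apply: le_trans (cmodD _ _) _; rewrite !cmodM cmod_zcc mulrDr.
  have := cmodD (f w - f z - l) l; rewrite subrK -cmodN opprB => hh.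
  apply: le_trans hh _; apply: le_trans (lerD hw hl) _; apply: le_trans he.
  rewrite /K expr2; have := cmod_ge0 (zc h).
  have : C * (cmod (zc h) * cmod (zc h)) <= C * d * cmod (zc h).
    by rewrite -mulrA ler_wpM2l // ler_wpM2r // cmod_ge0.
  nra.
split; apply/cvgrPdist_le => e /near_f; apply: filterS => w; apply: le_trans.
  by rewrite -raddfB normr_Re_le.
by rewrite -raddfB normr_Im_le.
Unshelve. all: by end_near.
Qed.

Definition Dfor (s : seq bool) c :=
  foldr (fun (b : bool) g => if b then Dx g else Dy g) c s.

Lemma series_Dseq r f c s : has_series r f c -> has_series r (Dseq s f) (Dfor s c).
Proof.
by move=> sf; elim: s => [//|[] s IH]; [exact: series_dx|exact: series_dy].
Qed.

Lemma series_smooth r f c : has_series r f c -> smooth_on (disc r) f.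
Proof.
move=> sf s z dz; have ss := series_Dseq s sf.
split; first by have [] := series_dx_dy ss dz.
exact: (series_continuous ss dz).
Qed.

End SeriesRepresentation.

(** * Agreement of the blocks with the Taylor polynomials at the origin *)

Section TaylorExpansion.
Variable R : realType.
Implicit Types (r : \bar R) (c : nat -> nat -> R[i]) (f : R * R -> R[i]) (z : R * R).

(** The Taylor coefficient computed formally: entry (0, 0) of a family is the value of its series at
    the origin. *)
Definition taylor_coef c (k l : nat) : R[i] :=
  iter k (@Dx R) (iter l (@Dy R) c) 0%N 0%N / (k`! * l`!)%:R.

Lemma DxDyC c : Dx (Dy c) = Dy (Dx c).
Proof.
apply/funext => k; apply/funext => l.
by rewrite /Dx /Dy /d1 /d2; ring.
Qed.

Lemma iter_Dy_Dx n c : iter n (@Dy R) (Dx c) = Dx (iter n (@Dy R) c).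
Proof. by elim: n => //= n ->; rewrite DxDyC. Qed.

Lemma taylor_coef_Dx c k l : d1 (taylor_coef c) k l = taylor_coef (Dx c) k l.
Proof.
rewrite /d1 /taylor_coef iter_Dy_Dx -iterSr factS -mulnA natrM.
have k0 : (k.+1%:R : R[i]) != 0 by rewrite pnatr_eq0.
have f0 : ((k`! * l`!)%:R : R[i]) != 0.
  by rewrite pnatr_eq0 -lt0n muln_gt0 !fact_gt0.
move: k0 f0; move: (k.+1%:R : R[i]) ((k`! * l`!)%:R : R[i]) => a b a0 b0.
by field; apply/andP.
Qed.

Lemma taylor_coef_Dy c k l : d2 (taylor_coef c) k l = taylor_coef (Dy c) k l.
Proof.
rewrite /d2 /taylor_coef -iterSr factS mulnCA natrM.
have k0 : (l.+1%:R : R[i]) != 0 by rewrite pnatr_eq0.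
have f0 : ((k`! * l`!)%:R : R[i]) != 0.
  by rewrite pnatr_eq0 -lt0n muln_gt0 !fact_gt0.
move: k0 f0; move: (l.+1%:R : R[i]) ((k`! * l`!)%:R : R[i]) => a b a0 b0.
by field; apply/andP.
Qed.

(* Both sides satisfy Euler's identity [(m+1) H_(m+1) = x (D_x H)_m + y (D_y H)_m]. *)
Lemma hsum_taylor c m z :
  hsum (taylor_coef c) m z.1%:C z.2%:C = hsum c m (zc z) (zcc z).
Proof.
elim: m c => [|m IH] c.
  by rewrite !hsum0 /taylor_coef /= divr1.
apply: (@mulfI _ (m.+1%:R)); first by rewrite pnatr_eq0.
rewrite -!hlin_euler !hlinS.
rewrite (eq_hsum (c' := taylor_coef (Dx c))); last by move=> *; apply: taylor_coef_Dx.
rewrite (eq_hsum (c := d2 _) (c' := taylor_coef (Dy c))); last by move=> *; apply: taylor_coef_Dy.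
rewrite !IH /Dx /Dy hsumD hsumZ hsumB.
rewrite zcE zccE; ring.
Qed.

Lemma Dfor_nseq c k l :
  Dfor (nseq k true ++ nseq l false) c = iter k (@Dx R) (iter l (@Dy R) c).
Proof.
rewrite /Dfor foldr_cat; have -> : foldr (fun (b : bool) g => if b then Dx g else Dy g) c (nseq l false) = iter l (@Dy R) c.
  by elim: l => //= l ->.
by elim: k => //= k ->.
Qed.

(** Every iterated derivative is again the sum of a series, and at the origin its blocks of positive
    degree vanish; so the actual Taylor coefficients are the formal ones. *)
Lemma series_fhom r f c m z : (0 < r)%E -> has_series r f c ->
  fhom f m z = hsum c m (zc z) (zcc z).
Proof.
move=> r0 sf; rewrite -hsum_taylor; apply: eq_bigr => k _.
rewrite /taylor_coef -Dfor_nseq !rmorphXn -!mulrA; congr (_ * _).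
have d0 : disc r (0, 0) by rewrite /disc /= expr0n /= addr0 sqrtr0.
have [_ /(_ _ d0) h] := series_Dseq (nseq k true ++ nseq (m - k) false) sf.
apply: csums_unique h _.
have z0 : zc (0, 0) = 0 :> R[i] by [].
have z0' : zcc (0, 0) = 0 :> R[i] by rewrite /zcc /= oppr0.
rewrite z0 z0' -[X in csums _ X](hsum0 (Dfor _ c) 0 0).
by apply: csums_head => n n0; apply: hsum_at0.
Qed.

Lemma cmod_zc_continuous : continuous (fun z : R * R => cmod (zc z)).
Proof.
move=> z; apply: (@continuous_comp _ _ _ (fun z : R * R => z.1 ^+ 2 + z.2 ^+ 2) (@Num.sqrt R)).
  by apply: cvgD; rewrite expr2; apply: cvgM;
    (apply: cvg_fst + apply: cvg_snd).
exact: sqrt_continuous.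
Qed.

(** The largest modulus on [K] is attained, hence stays below [r]. The empty set has no maximum and
    is treated apart. *)
Lemma compact_disc_radius (K : set (R * R)) r : (0 < r)%E -> compact K ->
  K `<=` disc r ->
  exists rho : R, [/\ 0 < rho, (rho%:E < r)%E & forall z, K z -> cmod (zc z) <= rho].
Proof.
move=> r0 cK Kr; have [K0|/set0P K0] := eqVneq K set0.
  by have [rho rho0 rr] := ereal_between r0; exists rho; split => // z; rewrite K0.
have [z zK hz] := compact_EVT_max K0 cK (continuous_subspaceT cmod_zc_continuous).
have [rho [rho0 zr rr]] := disc_radius (Kr z (set_mem zK)).
by exists rho; split => // w /mem_set/hz wz; apply: le_trans wz (ltW zr).
Qed.

(** On a compact set every block is bounded by the same geometric term, which yields both uniform
    clauses of [Aan]. *)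
Lemma series_Aan r f c : (0 < r)%E -> has_series r f c -> Aan r f.
Proof.
move=> r0 sf; split; first exact: series_smooth sf.
move=> K cK Kr; have [rho [rho0 rr Krho]] := compact_disc_radius r0 cK Kr.
have [C [q [q01 C0 hC]]] := hsum_geometric sf.1 rho0 rr.
have small (e : R) : 0 < e -> exists N, forall n, (N <= n)%N -> C * (q ^+ n / (1 - q)) < e.
  move=> e0; have q1 : `|q| < 1 by rewrite ger0_norm; lra.
  pose e' := e * (1 - q) / (C + 1).
  have e'0 : 0 < e' by rewrite divr_gt0 ?mulr_gt0 //; lra.
  have /cvgrPdist_lt/(_ e' e'0)[N _ hN] := cvg_expr q1.
  exists N => n Nn; have qn : 0 <= q ^+ n by rewrite exprn_ge0 //; lra.
  have h : `|0 - q ^+ n| < e' := hN n Nn.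
  move: h; rewrite distrC subr0 ger0_norm // /e' ltr_pdivlMr; last lra.
  by move=> h; rewrite mulrA ltr_pdivrMr; [nra|lra].
split=> e /small[N hN]; exists N.
  move=> n1 n2 /hN {}hN z /Krho zr; apply: le_lt_trans hN.
  apply: (@le_trans _ _ (\sum_(n1 <= m < n2) C * q ^+ m)).
    by apply: ler_sum => m _; rewrite (series_fhom _ _ r0 sf) hC.
  by rewrite -mulr_sumr ler_wpM2l // geometric_sum_le.
move=> n /hN {}hN z Kz; apply: le_lt_trans hN.
under eq_bigr do rewrite (series_fhom _ _ r0 sf).
exact: (csums_tail q01 (fun m => hC m z (Krho z Kz)) (sf.2 z (Kr z Kz))).
Qed.

End TaylorExpansion.

(** * From convergence by blocks to bounds on coefficients *)

Section FourierBound.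
Variable R : realType.
Implicit Types (c : nat -> nat -> R[i]) (f : R * R -> R[i]) (z : R * R).

(** [R[i]] is algebraically closed and X^n - 1 is separable, so there are n distinct n-th roots of
    unity, and one of them is primitive. *)
Lemma complex_prim_root (n : nat) : (0 < n)%N -> exists w : R[i], n.-primitive_root w.
Proof.
move=> n0; have [rs ers] := closed_field_poly_normal ('X^n - 1 : {poly R[i]}).
have n0' : (n%:R : R[i]) != 0 by rewrite pnatr_eq0 -lt0n.
have mon : lead_coef ('X^n - 1 : {poly R[i]}) = 1 by rewrite lead_coefXnsubC.
rewrite mon scale1r in ers.
have urs : uniq rs by rewrite -separable_prod_XsubC -ers separable_Xn_sub_1.
have szrs : size rs = n.
  by have := size_prod_XsubC rs id; rewrite -ers size_XnsubC // => -[].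
have : has n.-primitive_root rs.
  apply: has_prim_root => //; last by rewrite szrs.
  apply/allP => x; rewrite -root_prod_XsubC -ers => xr.
  by rewrite unity_rootE; move: xr; rewrite rootE !hornerE subr_eq0.
by case/hasP => w _ pw; exists w.
Qed.

Lemma sum_unity_root (n : nat) (w : R[i]) : w ^+ n = 1 -> w != 1 ->
  \sum_(j < n) w ^+ j = 0.
Proof.
move=> wn w1; apply: (@mulfI _ (w - 1)); first by rewrite subr_eq0.
by rewrite -subrX1 wn subrr mulr0.
Qed.

(* Averaging [H] against the characters of the group of (2m+1)-th roots of unity extracts
   one coefficient; the odd order separates the exponents [2 k - m] for [k = 0, ..., m]. *)
Lemma hsum_coef_le c m (rho B : R) : 0 < rho ->
  (forall z, cmod (zc z) <= rho -> cmod (hsum c m (zc z) (zcc z)) <= B) ->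
  forall k, (k <= m)%N -> cmod (c k (m - k)%N) * rho ^+ m <= B.
Proof.
move=> r0 hB k0 k0m.
have [w pw] := complex_prim_root (ltn0Sn (2 * m)); set n := (2 * m).+1 in pw.
have wn : w ^+ n = 1 := prim_expr_order pw.
have w0 : w != 0.
  by apply/eqP => w0; move: wn; rewrite w0 expr0n /= => /eqP; rewrite eq_sym oner_eq0.
have mw : cmod w = 1.
  have : cmod w ^+ n = 1 by rewrite -cmodX wn cmod1.
  by move/eqP; rewrite pexpr_eq1 ?cmod_ge0 // => /eqP.
have conjw (u : R[i]) : cmod u = 1 -> zcc (complex.Re u, complex.Im u) = u^-1.
  case: u => a b; rewrite /cmod /= => ab.
  have ab1 : a ^+ 2 + b ^+ 2 = 1.
    have := sqr_sqrtr (addr_ge0 (sqr_ge0 a) (sqr_ge0 b)).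
    by rewrite ab expr1n.
  have u0 : a +i* b != 0.
    by rewrite -cmod_eq0 /cmod /= ab oner_eq0.
  apply: (mulfI u0); rewrite divff // /zcc /=; simpc; apply/eqP; rewrite eq_complex /=.
  by apply/andP; split; apply/eqP; [rewrite -ab1; ring|ring].
pose pt (j : nat) : R * R := (rho * complex.Re (w ^+ j), rho * complex.Im (w ^+ j)).
have zpt j : zc (pt j) = rho%:C * w ^+ j.
  by rewrite /zc /pt /=; case: (w ^+ j) => a b; simpc.
have zcpt j : zcc (pt j) = rho%:C * (w ^+ j)^-1.
  by rewrite -conjw ?cmodX ?mw ?expr1n // /zcc /pt /=; simpc.
have cpt j : cmod (zc (pt j)) <= rho.
  by rewrite zpt cmodM cmodX mw expr1n mulr1 cmod_real gtr0_norm.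
(* At [pt j] the monomial of index k is rho^m times the j-th power of w^(2k - m); the quotient is
   used because 2k - m may be negative. *)
pose chi (k : nat) := w ^+ k / w ^+ (m - k).
have chi0 k : chi k != 0 by rewrite mulf_neq0 ?invr_eq0 ?expf_neq0.
have mchi k : cmod (chi k) = 1.
  by rewrite cmodM cmodV !cmodX mw !expr1n invr1 mulr1.
have Hpt j : hsum c m (zc (pt j)) (zcc (pt j)) =
    (rho ^+ m)%:C * \sum_(k < m.+1) c k (m - k)%N * chi k ^+ j.
  rewrite zpt zcpt hsum_scale rmorphXn; congr (_ * _); apply: eq_bigr => k _.
  by congr (_ * _); rewrite /chi expr_div_n exprVn -!exprM !(mulnC j).
have chi_inj k : (k <= m)%N -> chi k = chi k0 -> k = k0.
  move=> km e.
  have {}e : w ^+ (k + (m - k0)) = w ^+ (k0 + (m - k)).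
    have h1 : w ^+ (m - k) != 0 by rewrite expf_neq0.
    have h2 : w ^+ (m - k0) != 0 by rewrite expf_neq0.
    by move/eqP: e; rewrite /chi eqr_div // => /eqP; rewrite !exprD.
  (* Both exponents are at most 2m, hence below the order n, so they are equal as numbers. *)
  move/eqP: e; rewrite (eq_prim_root_expr pw) !modn_small; last 2 first.
  - by rewrite /n ltnS mul2n -addnn; apply: leq_add; rewrite ?leq_subr.
  - by rewrite /n ltnS mul2n -addnn; apply: leq_add; rewrite ?leq_subr.
  by move/eqP; lia.
have orth k : (k <= m)%N -> k != k0 -> \sum_(j < n) (chi k / chi k0) ^+ j = 0.
  move=> km kk0; apply: sum_unity_root.
    by rewrite expr_div_n /chi !expr_div_n -!exprM !(mulnC _ n) !exprM wn !expr1n !divr1.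
  by apply: contra kk0 => /eqP e; apply/eqP/chi_inj => //; rewrite -[LHS](divfK (chi0 k0)) e mul1r.
have key : \sum_(j < n) hsum c m (zc (pt j)) (zcc (pt j)) / chi k0 ^+ j =
    n%:R * ((rho ^+ m)%:C * c k0 (m - k0)%N).
  under eq_bigr do rewrite Hpt -mulrA mulr_suml.
  rewrite -mulr_sumr exchange_big /= mulrCA; congr (_ * _).
  rewrite (bigD1 (Ordinal (k0m : (k0 < m.+1)%N))) //= [X in _ + X]big1 ?addr0.
    under eq_bigr do rewrite mulfK ?expf_neq0 //.
    by rewrite sumr_const card_ord mulr_natl.
  move=> k kk0; under eq_bigr do rewrite -mulrA -expr_div_n.
  by rewrite -mulr_sumr orth ?mulr0 // -ltnS.
have n0 : 0 < (n%:R : R) by rewrite ltr0n.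
rewrite -(ler_pM2l n0).
have -> : n%:R * (cmod (c k0 (m - k0)%N) * rho ^+ m) =
    cmod (n%:R * ((rho ^+ m)%:C * c k0 (m - k0)%N)).
  rewrite !cmodM cmod_nat cmod_real ger0_norm ?exprn_ge0 ?ltW //.
  by rewrite (mulrC (rho ^+ m)).
rewrite -key; apply: le_trans (cmod_sum _ _ _) _.
have -> : n%:R * B = \sum_(j < n) B by rewrite sumr_const card_ord mulr_natl.
apply: ler_sum => j _; rewrite cmodM cmodV cmodX mchi expr1n invr1 mulr1.
exact: hB.
Qed.

Lemma hsum_eq0_coef c m : (forall z, hsum c m (zc z) (zcc z) = 0) ->
  forall k, (k <= m)%N -> c k (m - k)%N = 0.
Proof.
move=> h k km; apply/eqP; rewrite -cmod_eq0 eq_le cmod_ge0 andbT.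
have := @hsum_coef_le c m 1 0 ltr01; rewrite expr1n => /(_ _ k km).
by rewrite mulr1; apply => z _; rewrite h cmod0.
Qed.

(** x and y are linear forms in zeta and zeta', so the class [hom] is closed under multiplication by
    them; this avoids expanding binomials. In a fixed degree the first exponent determines the
    second, so coefficients carry one index. *)
Lemma hsum_of_real_form (b : nat -> nat -> R[i]) m :
  exists c : nat -> R[i], forall z,
    hsum b m z.1%:C z.2%:C = hsum (fun k _ => c k) m (zc z) (zcc z).
Proof.
pose hom n (F : R * R -> R[i]) := exists c : nat -> R[i], forall z,
    F z = \sum_(k < n.+1) c k * (zc z ^+ k * zcc z ^+ (n - k)).
have homD n F G : hom n F -> hom n G -> hom n (fun z => F z + G z).
  move=> [c hc] [d hd]; exists (fun k => c k + d k) => z.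
  by rewrite hc hd -big_split; apply: eq_bigr => k _; rewrite mulrDl.
have homZ n F a : hom n F -> hom n (fun z => a * F z).
  move=> [c hc]; exists (fun k => a * c k) => z.
  by rewrite hc mulr_sumr; apply: eq_bigr => k _; rewrite mulrA.
have homzc n F : hom n F -> hom n.+1 (fun z => zc z * F z).
  move=> [c hc]; exists (fun k => if k is k'.+1 then c k' else 0) => z.
  rewrite big_ord_recl mul0r add0r hc mulr_sumr; apply: eq_bigr => k _.
  by rewrite /bump /= ?add1n subSS exprS; ring.
have homzcc n F : hom n F -> hom n.+1 (fun z => zcc z * F z).
  move=> [c hc]; exists (fun k => if (k <= n)%N then c k else 0) => z.
  rewrite big_ord_recr /= ltnn mul0r addr0 hc mulr_sumr; apply: eq_bigr => k _.
  have kn : (k <= n)%N by rewrite -ltnS.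
  by rewrite kn subSn // exprS; ring.
have ext n F G : F =1 G -> hom n F -> hom n G.
  by move=> FG [c hc]; exists c => z; rewrite -FG.
have homx n F : hom n F -> hom n.+1 (fun z => z.1%:C * F z).
  move=> hF; apply: ext (homD _ _ _ (homZ _ _ (2%:R^-1) (homzc _ _ hF)) (homZ _ _ (2%:R^-1) (homzcc _ _ hF))) => z.
  have -> : z.1%:C = 2%:R^-1 * (zc z + zcc z).
    by rewrite zcE zccE; field.
  by rewrite /=; ring.
have homy n F : hom n F -> hom n.+1 (fun z => z.2%:C * F z).
  move=> hF; apply: ext (homD _ _ _ (homZ _ _ (- 'i / 2%:R) (homzc _ _ hF)) (homZ _ _ ('i / 2%:R) (homzcc _ _ hF))) => z.
  have -> : z.2%:C = ('i / 2%:R) * (zcc z - zc z).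
    have -> : 'i / 2%:R * (zcc z - zc z) = - 'i ^+ 2 * z.2%:C.
      by rewrite zcE zccE; field.
    by rewrite sqr_i opprK mul1r.
  by rewrite /=; ring.
have hom1 : hom 0%N (fun _ => 1).
  by exists (fun _ => 1) => z; rewrite big_ord1 mul1r !expr0 mulr1.
have mono k l : hom (k + l)%N (fun z => z.1%:C ^+ k * z.2%:C ^+ l).
  elim: k => [|k IH].
    elim: l => [|l IH]; first by apply: ext hom1 => z; rewrite !expr0 mulr1.
    by apply: ext (homy _ _ IH) => z; rewrite !exprS; ring.
  by apply: ext (homx _ _ IH) => z; rewrite !exprS; ring.
have hom0 : hom m (fun _ => 0).
  by exists (fun _ => 0) => z; rewrite big1 // => k _; rewrite mul0r.
have [c hc] : hom m (fun z => hsum b m z.1%:C z.2%:C).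
  rewrite /hsum; elim: (index_enum _) => [|k s IH].
    by apply: ext hom0 => z; rewrite big_nil.
  apply: ext (homD _ _ _ (homZ m _ (b k (m - k)%N) _) IH) => [z|]; first by rewrite big_cons.
  by have := mono k (m - k)%N; rewrite ord_subnKC.
by exists c.
Qed.

Lemma closed_disc_compact (rho : R) : compact [set z : R * R | cmod (zc z) <= rho].
Proof.
apply: (@subclosed_compact _ _ (`[- rho, rho] `*` `[- rho, rho])).
- rewrite (_ : [set z | _] = (fun z => cmod (zc z)) @^-1` [set x | x <= rho]) //.
  apply: closed_comp; last exact: closed_le.
  by move=> z _; apply: cmod_zc_continuous.
- by apply: compact_setX; apply: segment_compact.
move=> z /= zr; split; rewrite /= in_itv /= -ler_norml.
  exact: le_trans (normr_Re_le (zc z)) zr.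
exact: le_trans (normr_Im_le (zc z)) zr.
Qed.

(** Absolute convergence on the closed disc of radius rho bounds the blocks of degree at least N by
    1, and averaging passes this bound to their coefficients. The finitely many coefficients of
    lower degree are bounded by a finite sum. *)
Lemma Aan_series (r : \bar R) f : (0 < r)%E -> Aan r f -> exists c, has_series r f c.
Proof.
move=> r0 [_ hf].
have /choice[C hC] : forall m, exists C : nat -> R[i], forall z,
    fhom f m z = hsum (fun k _ => C k) m (zc z) (zcc z).
  move=> m; have [c hc] := hsum_of_real_form (fun k l => tcoef f k l / (k`! * l`!)%:R) m.
  exists c => z; rewrite -hc; apply: eq_bigr => k _.
  by rewrite !rmorphXn mulrA.
pose c k l := C (k + l)%N k.
have fc m z : fhom f m z = hsum c m (zc z) (zcc z).
  by rewrite hC; apply: eq_hsum => k l <-.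
exists c; split.
  move=> rho rho0 rr.
  have sub : [set z : R * R | cmod (zc z) <= rho] `<=` disc r.
    by move=> z zr; apply: le_lt_trans rr; rewrite lee_fin.
  have [/(_ 1 ltr01)[N hN] _] := hf _ (@closed_disc_compact rho) sub.
  pose S := \sum_(k < N) \sum_(l < N) cmod (c k l) * rho ^+ (k + l).
  have pos k l : 0 <= cmod (c k l) * rho ^+ (k + l).
    by rewrite mulr_ge0 ?cmod_ge0 ?exprn_ge0 // ltW.
  have S0 : 0 <= S by do 2 (apply: sumr_ge0 => ? _).
  exists (1 + S) => k l; have [klN|Nkl] := ltnP (k + l) N.
    have kN : (k < N)%N by apply: leq_ltn_trans klN; apply: leq_addr.
    have lN : (l < N)%N by apply: leq_ltn_trans klN; apply: leq_addl.
    rewrite /S (bigD1 (Ordinal kN)) //= (bigD1 (Ordinal lN)) //=.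
    set A := \sum_(i < N | _) _; set B := \sum_(i < N | _) _.
    have A0 : 0 <= A by apply: sumr_ge0 => ? _.
    have B0 : 0 <= B by apply: sumr_ge0 => ? _; apply: sumr_ge0 => ? _.
    by lra.
  have b z : cmod (zc z) <= rho -> cmod (hsum c (k + l) (zc z) (zcc z)) <= 1.
    by move=> /(hN _ (k + l).+1 Nkl); rewrite big_nat1 fc => /ltW.
  have := hsum_coef_le rho0 b (leq_addr l k); rewrite addKn; lra.
move=> z dz; have dz1 : [set z] `<=` disc r by move=> _ ->.
have [_ h] := hf _ (@compact_set1 _ z) dz1.
move=> e /h[N hN]; exists N => n /hN/(_ z erefl).
by under eq_bigr do rewrite fc.
Qed.

End FourierBound.

(** * The iterated Laplacian on coefficients *)

Section IteratedLaplacian.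
Variable R : realType.
Implicit Types (r : \bar R) (c : nat -> nat -> R[i]) (f : R * R -> R[i]).

Definition lap c (k l : nat) : R[i] := (4 * (k.+1 * l.+1))%:R * c k.+1 l.+1.

Lemma series_laplace r f c : has_series r f c -> has_series r (laplace f) (lap c).
Proof.
move=> sf; have [gx sx] := series_dx (series_dx sf); have [gy sy] := series_dy (series_dy sf).
have e k l : lap c k l = Dx (Dx c) k l + Dy (Dy c) k l.
  (* The two pure second derivatives appear with the factor 1 + i^2 = 0, the mixed one with 1 - i^2
     = 2. *)
  have -> : Dx (Dx c) k l + Dy (Dy c) k l =
      (k.+1%:R * (k.+2%:R * c k.+2 l) + l.+1%:R * (l.+2%:R * c k l.+2)) * (1 + 'i ^+ 2)
      + 2%:R * (k.+1%:R * l.+1%:R) * c k.+1 l.+1 * (1 - 'i ^+ 2).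
    rewrite /Dx /Dy /d1 /d2; ring.
  by rewrite sqr_i subrr mulr0 add0r opprK /lap !natrM; ring.
split.
  have g := growthD gx gy; move=> rho r0 rr; have [C hC] := g rho r0 rr.
  by exists C => k l; rewrite e.
move=> z dz; apply: eq_csums (csumsD (sx z dz) (sy z dz)) => m.
by rewrite -hsumD; apply: eq_hsum => k l _; rewrite e.
Qed.

Lemma series_iter_laplace r f c p : has_series r f c ->
  has_series r (iter p (@laplace R) f) (iter p lap c).
Proof. by move=> sf; elim: p => //= p; apply: series_laplace. Qed.

(** In closed form 4^p (k + p)! (l + p)! / (k! l!). Being a positive natural number, it can be
    divided by without increasing a modulus. *)
Fixpoint lap_weight (p k l : nat) : nat :=
  if p is p'.+1 then (4 * (k.+1 * l.+1)) * lap_weight p' k.+1 l.+1 else 1%N.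

Lemma lap_weight_gt0 p k l : (0 < lap_weight p k l)%N.
Proof. by elim: p k l => //= p IH k l; rewrite !muln_gt0 IH. Qed.

Lemma iter_lap p c k l :
  iter p lap c k l = (lap_weight p k l)%:R * c (k + p)%N (l + p)%N.
Proof.
elim: p k l => [|p IH] k l; first by rewrite /= mul1r !addn0.
by rewrite iterS /lap IH mulrA -natrM !addnS !addSn.
Qed.

End IteratedLaplacian.

(** * The nodes and the factorisation of [Pa] *)

Section Nodes.
Variables (R : realType) (a : nat -> R).

(* Node [0] belongs to the line [y = 0], i.e. to the slope parameter [a = oo], where [A = 1]. *)
Definition node (i : nat) : R[i] := if i == 0%N then 1 else Acx (a i.-1).

Lemma subi_neq0 (x : R) : x%:C - 'i != 0.
Proof.
apply/eqP => /eqP; rewrite eq_complex /= => /andP[_].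
by rewrite sub0r oppr_eq0 oner_eq0.
Qed.

Lemma cmod_Acx (x : R) : cmod (Acx x) = 1.
Proof.
rewrite /Acx cmodM cmodV.
have -> : cmod (x%:C + 'i) = cmod (x%:C - 'i).
  by rewrite /cmod /= !add0r !addr0 ?oppr0 ?addr0 sqrrN.
by rewrite divff // cmod_eq0 subi_neq0.
Qed.

(** The Cayley transform of the real line misses 1, its limit at infinity; hence node [0] is
    distinct from the others. *)
Lemma Acx_neq1 (x : R) : Acx x != 1.
Proof.
apply/eqP => /(congr1 ( *%R^~ (x%:C - 'i))); rewrite /Acx divfK ?subi_neq0 // mul1r.
move=> /eqP; rewrite eq_complex /= => /andP[_ /eqP].
by rewrite add0r sub0r; lra.
Qed.

Lemma Acx_inj : injective (@Acx R).
Proof.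
move=> x y /eqP; rewrite /Acx eqr_div ?subi_neq0 // => /eqP h.
have : 2%:R * 'i * (y%:C - x%:C) = 0.
  have -> : 2%:R * 'i * (y%:C - x%:C) =
    (x%:C + 'i) * (y%:C - 'i) - (y%:C + 'i) * (x%:C - 'i) by ring.
  by rewrite h subrr.
move/eqP; rewrite !mulf_eq0 pnatr_eq0 /= -cmod_eq0 cmod_i oner_eq0 /= subr_eq0.
by move=> /eqP[].
Qed.

Lemma cmod_node i : cmod (node i) = 1.
Proof. by rewrite /node; case: eqP => _; rewrite ?cmod1 ?cmod_Acx. Qed.

Lemma node_inj n : (forall i j, (i < n.-1)%N -> (j < n.-1)%N -> a i = a j -> i = j) ->
  forall i j, (i < n)%N -> (j < n)%N -> node i = node j -> i = j.
Proof.
move=> ainj [|i] [|j] //= hi hj; rewrite /node /=.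
- by move/esym/eqP; rewrite (negPf (Acx_neq1 _)).
- by move/eqP; rewrite (negPf (Acx_neq1 _)).
- by move/Acx_inj => /ainj -> //; case: n hi hj {ainj} => // n; rewrite !ltnS.
Qed.

(* The [zeta]-exponent attached to column [j] of [M_m]. *)
Definition expo (p m j : nat) : nat := if (j < p)%N then j else (m + j + 1)%N.

Lemma MmatE m p (i j : 'I_(2 * p)) : Mmat m p a i j = node i ^+ expo p m j.
Proof. by rewrite mxE /node; case: eqP => _ //; rewrite expr1n. Qed.

Definition node_pt (i : nat) : R * R := if i == 0%N then (1, 0) else (a i.-1, 1).

Lemma zc_node_pt i : zc (node_pt i) = node i * zcc (node_pt i).
Proof.
rewrite /node_pt /node; case: eqP => _.
  by rewrite zcE zccE /= mulr0 addr0 subr0 mul1r.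
by rewrite zcE zccE /= mulr1 /Acx divfK ?subi_neq0.
Qed.

Lemma zcc_node_pt_neq0 i : zcc (node_pt i) != 0.
Proof.
rewrite /node_pt; case: (i == 0%N); rewrite zccE /= ?mulr1 ?subi_neq0 //.
by rewrite mulr0 subr0 oner_eq0.
Qed.

Lemma Pa_factor p : (0 < p)%N -> exists2 kappa : R[i], kappa != 0 &
  forall z, (Pa p a z)%:C = kappa * \prod_(i < 2 * p) (zc z - node i * zcc z).
Proof.
move=> p0; have [n en] : exists n, (2 * p)%N = n.+1.
  by exists (2 * p).-1; rewrite prednK // muln_gt0.
(* The constant collects y = - (i / 2) (zeta - zeta') and x - a_j y = (i / 2) (a_j - i) (zeta - A_j
   zeta'). *)
exists (- 'i / 2%:R * \prod_(j < n) ('i * ((a j)%:C - 'i) / 2%:R)).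
  have i0 : 'i != 0 :> R[i] by rewrite -cmod_eq0 cmod_i oner_eq0.
  have t0 : 2%:R^-1 != 0 :> R[i] by rewrite invr_eq0 pnatr_eq0.
  rewrite mulf_neq0 //; first by rewrite mulf_neq0 // oppr_eq0.
  by apply/prodf_neq0 => j _; rewrite !mulf_neq0 // subi_neq0.
move=> z; rewrite /Pa en /= big_ord_recl mulrACA -big_split rmorphM rmorph_prod /=.
congr (_ * _).
  have -> : - 'i / 2%:R * (zc z - node 0 * zcc z) = - 'i ^+ 2 * z.2%:C.
    by rewrite zcE zccE /node /= mul1r; field.
  by rewrite sqr_i opprK mul1r.
apply: eq_bigr => j _; rewrite /node /= ?add0n ?/bump /= rmorphB rmorphM /=.
have s0 := subi_neq0 (a j).
have -> : 'i * ((a j)%:C - 'i) / 2%:R * (zc z - Acx (a j) * zcc z) =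
   - 'i ^+ 2 * z.1%:C + 'i ^+ 2 * (a j)%:C * z.2%:C.
  rewrite zcE zccE /Acx; field; exact: s0.
by rewrite sqr_i; ring.
Qed.

End Nodes.

(** In degree m + 2p both exponents are at least p exactly when p <= k <= m + p; the 2p other values
    of k are the exponents in the columns of M_m. *)
Lemma sum_split_expo (V : zmodType) (F : nat -> V) (p m : nat) :
  \sum_(k < (m + 2 * p).+1) F k =
    \sum_(j < 2 * p) F (expo p m j) + \sum_(k < m.+1) F (k + p)%N.
Proof.
rewrite -(big_mkord predT F) -(big_mkord predT (fun j => F (expo p m j))).
rewrite (@big_cat_nat _ _ _ p) //=; last by lia.
rewrite (@big_cat_nat _ _ _ (m.+1 + p) p) //=; [|lia|lia].
rewrite (@big_cat_nat _ _ _ p 0 (2 * p)) //=; last by lia.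
rewrite -addrA; congr (_ + _).
  by apply: eq_big_nat => j /andP[_ jp]; rewrite /expo jp.
rewrite addrC; congr (_ + _).
  have -> : (m.+1 + p = p + m.+1)%N by lia.
  rewrite big_addn; have -> : ((m + 2 * p).+1 - m.+1 = 2 * p)%N by lia.
  apply: eq_big_nat => j /andP[pj _]; rewrite /expo ltnNge pj /=.
  by congr F; lia.
by rewrite -[X in \sum_(X <= _ < _) _](add0n p) big_addn addnK big_mkord.
Qed.

(** * Cramer's rule with bounds *)

Section CramerBound.
Variable R : realType.

Lemma cmod_prod (I : finType) (F : I -> R[i]) : cmod (\prod_i F i) = \prod_i cmod (F i).
Proof. exact: (big_morph _ (@cmodM R) (cmod1 R)). Qed.

(** The Leibniz expansion has n! terms of modulus at most 1; this crude bound suffices because the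
    size 2p does not depend on m. *)
Lemma cmod_det_le n (A : 'M[R[i]]_n) : (forall i j, cmod (A i j) <= 1) ->
  cmod (\det A) <= n`!%:R.
Proof.
move=> A1; apply: le_trans (cmod_sum _ _ _) _.
apply: (@le_trans _ _ (\sum_(s : 'S_n) 1)).
  apply: ler_sum => s _; rewrite cmodM cmodX cmodN cmod1 expr1n mul1r cmod_prod.
  by apply: prodr_ile1 => i; rewrite cmod_ge0 A1.
by rewrite sumr_const -card_Sn.
Qed.

(** The inverse is the adjugate over the determinant; the minors in the adjugate are at most (n -
    1)! in modulus, rounded up to n!. *)
Lemma cramer_bound n (A : 'M[R[i]]_n) (b : 'cV[R[i]]_n) (B : R) :
  (forall i j, cmod (A i j) <= 1) -> \det A != 0 -> (forall i, cmod (b i 0) <= B) ->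
  exists2 x : 'cV[R[i]]_n, A *m x = b &
    forall j, cmod (x j 0) <= (n`! * n)%:R * B / cmod (\det A).
Proof.
move=> A1 d0 bB; exists ((\det A)^-1 *: (\adj A *m b)).
  by rewrite -scalemxAr mulmxA mul_mx_adj mul_scalar_mx scalerA mulVf // scale1r.
move=> j; rewrite mxE cmodM cmodV mulrC ler_pM2r ?invr_gt0 ?cmod_gt0 //.
have B0 : 0 <= B by apply: le_trans (bB j); apply: cmod_ge0.
rewrite mxE; apply: le_trans (cmod_sum _ _ _) _.
apply: (@le_trans _ _ (\sum_(i < n) n`!%:R * B)).
  apply: ler_sum => i _; rewrite cmodM; apply: ler_pM; rewrite ?cmod_ge0 //.
  rewrite mxE /cofactor cmodM cmodX cmodN cmod1 expr1n mul1r.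
  apply: (@le_trans _ _ n.-1`!%:R).
    by apply: cmod_det_le => i' j'; rewrite !mxE.
  by rewrite ler_nat; case: (n) => //= n'; rewrite factS leq_pmull.
by rewrite sumr_const card_ord natrM -[leLHS]mulr_natr mulrAC.
Qed.

End CramerBound.

(** * Division of forms by unimodular linear factors *)

Section Division.
Variable R : realType.
Implicit Types (Q q : {poly R[i]}).

(** Homogenisation of [Q] in degree n, which makes the factor theorem for one variable available.
    Coefficients above n are dropped, hence the size conditions below. *)
Definition hpoly (n : nat) Q (X Y : R[i]) : R[i] :=
  \sum_(k < n.+1) Q`_k * (X ^+ k * Y ^+ (n - k)).

Lemma hpoly_mulXsubC n q w X Y : (size q <= n.+1)%N ->
  hpoly n.+1 (q * ('X - w%:P)) X Y = (X - w * Y) * hpoly n q X Y.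
Proof.
move=> sq; rewrite /hpoly mulrBl !mulr_sumr.
under eq_bigr do rewrite mulrBr coefB coefMX coefMC mulrBl.
rewrite sumrB; congr (_ - _).
  rewrite big_ord_recl /= mul0r add0r; apply: eq_bigr => k _.
  by rewrite /bump /= ?add1n subSS exprS; ring.
rewrite big_ord_recr /= nth_default // mul0r mul0r addr0; apply: eq_bigr => k _.
by rewrite subSn; [rewrite exprS; ring|rewrite -ltnS].
Qed.

(** With b_n the coefficients of the product, w q_n = q_(n-1) - b_n; as |w| = 1, each step adds at
    most B to the bound. *)
Lemma coef_quotient_le q (w : R[i]) (B : R) (N : nat) : cmod w = 1 ->
  (size (q * ('X - w%:P))%R <= N)%N ->
  (forall k, cmod (q * ('X - w%:P))`_k <= B) -> forall k, cmod q`_k <= N%:R * B.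
Proof.
move=> w1 sN hB k.
have B0 : 0 <= B := le_trans (cmod_ge0 _) (hB 0%N).
have [kN|Nk] := ltnP k N; last first.
  rewrite nth_default ?cmod0 ?mulr_ge0 ?ler0n //; apply: leq_trans Nk.
  have [->|q0] := eqVneq q 0; first by rewrite size_poly0.
  by move: sN; rewrite size_mul ?polyXsubC_eq0 // size_XsubC addn2 /=; apply: ltnW.
suff h j : cmod q`_j <= j.+1%:R * B.
  by apply: le_trans (h k) _; rewrite ler_wpM2r // ler_nat.
have eq0 n : w * q`_n = (if n == 0%N then 0 else q`_n.-1) - (q * ('X - w%:P))`_n.
  by rewrite mulrBr coefB coefMX coefMC opprB addrCA subrr addr0 mulrC.
have eqw n : cmod q`_n = cmod (w * q`_n) by rewrite cmodM w1 mul1r.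
elim: j => [|j IH]; first by rewrite eqw eq0 /= sub0r cmodN mul1r.
rewrite eqw eq0 /=.
apply: le_trans (cmodB _ _) _; rewrite -natr1 mulrDl mul1r.
exact: lerD.
Qed.

(** Splitting off one root keeps the others, as they are distinct, so the factors are removed in
    turn; each division costs at most the degree plus one. *)
Lemma hpoly_divide (rs : seq R[i]) n Q (B : R) :
  uniq rs -> (forall w, w \in rs -> cmod w = 1 /\ root Q w) ->
  (size Q <= (n + size rs).+1)%N -> (forall k, cmod Q`_k <= B) ->
  exists q, [/\ (forall X Y, hpoly (n + size rs) Q X Y =
      (\prod_(w <- rs) (X - w * Y)) * hpoly n q X Y) &
    forall k, cmod q`_k <= (n + size rs).+1%:R ^+ size rs * B].
Proof.
elim: rs Q B => [|w rs IH] Q B.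
  move=> _ _ sQ hB; exists Q; split => [X Y|k]; first by rewrite big_nil mul1r addn0.
  by rewrite expr0 mul1r.
rewrite cons_uniq => /andP[wrs urs] hr sQ hB.
have [w1 /factor_theorem[q1 eQ]] := hr w (mem_head _ _).
have B0 : 0 <= B := le_trans (cmod_ge0 _) (hB 0%N).
have sq1 : (size q1 <= (n + size rs).+1)%N.
  have [->|q0] := eqVneq q1 0; first by rewrite size_poly0.
  by move: sQ; rewrite eQ size_mul ?polyXsubC_eq0 // size_XsubC /= addn2 /= addnS ltnS.
have bq1 k : cmod q1`_k <= (n + size rs).+2%:R * B.
  by apply: (coef_quotient_le w1) k; rewrite -eQ // (leq_trans sQ) //= addnS.
have [|q [hq bq]] := IH q1 _ urs _ sq1 bq1.
  move=> v vrs; have [|v1 rv] := hr v; first by rewrite inE vrs orbT.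
  split => //.
  move: rv; rewrite eQ rootM => /orP[//|]; rewrite root_XsubC => /eqP vw.
  by move: wrs; rewrite -vw vrs.
exists q; split => [X Y|k].
  by rewrite addnS big_cons -mulrA -hq eQ hpoly_mulXsubC.
apply: le_trans (bq k) _; rewrite /= addnS exprSr -mulrA.
rewrite ler_wpM2r ?mulr_ge0 // lerXn2r // ?nnegrE // ler_nat //.
Qed.

End Division.

(** * The constant [tau] and the size of the determinants *)

Section Tau.
Variables (R : realType) (p : nat) (a : nat -> R).

Lemma Mmat_entry_le1 m i j : cmod (Mmat m p a i j) <= 1.
Proof. by rewrite MmatE cmodX cmod_node expr1n. Qed.

Lemma tau_lt_eventually (s : R) : 0 < s -> (s%:E < tau p a)%E ->
  exists N, forall m, (N <= m)%N -> s ^+ m <= cmod (\det (Mmat m p a)).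
Proof.
move=> s0; rewrite /tau limn_einf_lim; set u := (fun m : nat => _).
have -> : limn (einfs u) = ereal_sup (range (einfs u)).
  by apply/cvg_lim => //; exact: cvg_einfs_sup.
(* The successor excludes m = 0, where the exponent 1 / m takes the value 0. *)
move=> /ereal_sup_gt[_ [N _ <-] sN]; exists N.+1 => m Nm.
have m0 : (m%:R : R) != 0 by rewrite pnatr_eq0; case: m Nm.
have : (s%:E < u m)%E.
  by apply: lt_le_trans sN _; apply: ereal_inf_lbound; exists m => //=; apply: ltnW.
rewrite /u lte_fin => /ltW h.
have := lerXn2r m (ltW s0 : s \is Num.nneg) (powR_ge0 _ _ : _ \is Num.nneg) h.
by rewrite -[X in _ <= X]powR_mulrn ?powR_ge0 // -powRrM mulVf // powRr1 ?cmod_ge0.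
Qed.

(** The determinants are bounded by (2p)!, so they cannot grow like s^m with s > 1. *)
Lemma tau_le1 : (tau p a <= 1%:E)%E.
Proof.
rewrite leNgt; apply/negP => /ereal_between[s s1 st].
have s0 : 0 < s by lra.
have [N hN] := tau_lt_eventually s0 st.
have [C hC] := @poly_geometric_le R 1 s^-1 ltac:(rewrite invr_ge0 ltW //= invf_lt1 //).
have hb m : (N <= m)%N -> s ^+ m <= (2 * p)`!%:R.
  by move=> /hN h; apply: le_trans h _; apply: cmod_det_le => i j; apply: Mmat_entry_le1.
(* Chosen with m + 1 > C (2p)!, against (m + 1) s^(-m) <= C and s^m <= (2p)!. *)
pose m := maxn N (Num.truncn (C * (2 * p)`!%:R)).
have := hb m (leq_maxl _ _); have := hC m; rewrite expr1 exprVn.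
rewrite ler_pdivrMr ?exprn_gt0 // => h1 h2.
have C0 : 0 <= C by apply: le_trans (hC 0%N); rewrite mulr_ge0 // exprn_ge0 // invr_ge0 ltW.
have h3 : m.+1%:R <= C * (2 * p)`!%:R by apply: le_trans h1 _; rewrite ler_wpM2l.
have := truncnS_gt (C * (2 * p)`!%:R); rewrite ltNge => /negP; apply.
apply: le_trans h3; rewrite ler_nat ltnS; exact: leq_maxr.
Qed.

Lemma tau_det_bound (s : R) : (forall m, \det (Mmat m p a) != 0) ->
  0 < s -> (s%:E < tau p a)%E ->
  exists C, forall m, (cmod (\det (Mmat m p a)))^-1 * s ^+ m <= C.
Proof.
move=> d0 s0 /(tau_lt_eventually s0)[N hN].
have pos m : 0 <= (cmod (\det (Mmat m p a)))^-1 * s ^+ m.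
  by rewrite mulr_ge0 ?invr_ge0 ?cmod_ge0 ?exprn_ge0 ?ltW.
exists (1 + \sum_(m < N) (cmod (\det (Mmat m p a)))^-1 * s ^+ m) => m.
have [mN|/hN h] := ltnP m N.
  rewrite (bigD1 (Ordinal mN)) //= addrCA lerDl addr_ge0 // sumr_ge0 //.
have : (cmod (\det (Mmat m p a)))^-1 * s ^+ m <= 1.
  by rewrite ler_pdivrMl ?cmod_gt0 // mulr1.
by move=> /le_trans; apply; rewrite lerDl sumr_ge0.
Qed.

End Tau.

(** * Uniqueness of the coefficients *)

Section SeriesUniqueness.
Variable R : realType.
Implicit Types (r : \bar R) (c : nat -> nat -> R[i]) (f : R * R -> R[i]) (z : R * R).

Lemma has_series_sub r r' f c : (r <= r')%E -> has_series r' f c -> has_series r f c.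
Proof.
move=> rr' [gc fc]; split; first exact: growth_sub gc.
by move=> z dz; apply: fc; apply: lt_le_trans dz rr'.
Qed.

Lemma growth_has_series r c : growth r c -> exists f, has_series r f c.
Proof.
move=> gc; have /choice[f hf] : forall z, exists s, disc r z ->
    csums (fun m => hsum c m (zc z) (zcc z)) s.
  move=> z; have [dz|ndz] := pselect (disc r z); last by exists 0.
  by have [s hs] := hsum_summable gc dz; exists s.
by exists f; split.
Qed.

(** Along the line spanned by [e] both functions are power series in t whose m-th coefficient is the
    block of degree m at [e]. Agreement on one line is all that the zero set of [Pa] provides for
    each node. *)
Lemma series_line_unique r f f' c c' (e : R * R) : (0 < r)%E ->
  has_series r f c -> has_series r f' c' ->
  (forall t : R, disc r (t * e.1, t * e.2) -> f (t * e.1, t * e.2) = f' (t * e.1, t * e.2)) ->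
  forall m, hsum c m (zc e) (zcc e) = hsum c' m (zc e) (zcc e).
Proof.
move=> r0 [_ fc] [_ fc'] ff' m; apply/eqP; rewrite -subr_eq0; apply/eqP; move: m.
have [rho rho0 rr] := ereal_between r0.
have e0 : 0 < cmod (zc e) + 1 by have := cmod_ge0 (zc e); lra.
(* For t up to this bound t e stays within radius rho; the summand 1 covers [e] = 0. *)
apply: (@power_series_eq0 _ _ (rho / (cmod (zc e) + 1))); first exact: divr_gt0.
move=> t /andP[t0 te].
have ezc : zc (t * e.1, t * e.2) = t%:C * zc e by rewrite /zc; simpc.
have ezcc : zcc (t * e.1, t * e.2) = t%:C * zcc e by rewrite /zcc; simpc.
have dt : disc r (t * e.1, t * e.2).
  apply: le_lt_trans rr; rewrite lee_fin -[X in X <= _]/(cmod (zc (t * e.1, t * e.2))).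
  rewrite ezc cmodM cmod_real gtr0_norm //.
  move: te; rewrite ler_pdivlMr // => /(le_trans _); apply.
  by rewrite ler_pM2l //; lra.
have := csumsB (fc _ dt) (fc' _ dt); rewrite ff' // subrr; apply: eq_csums => m.
by rewrite ezc ezcc !hsum_scale rmorphXn mulrBr.
Qed.

Lemma series_unique r f f' c c' : (0 < r)%E ->
  has_series r f c -> has_series r f' c' -> (forall z, disc r z -> f z = f' z) ->
  forall k l, c k l = c' k l.
Proof.
move=> r0 sf sf' ff' k l; apply/eqP; rewrite -subr_eq0.
have := @hsum_eq0_coef R (fun k l => c k l - c' k l) (k + l).
move=> /(_ _ k (leq_addr l k)); rewrite addKn => -> // z.
rewrite hsumB (series_line_unique (e := z) r0 sf sf') ?subrr // => t.
exact: ff'.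
Qed.

End SeriesUniqueness.

(** * Bookkeeping of interior and boundary exponents *)

Section ExponentArithmetic.
Variables (p m : nat).

Lemma expo_boundary j : (j < 2 * p)%N ->
  (p <= expo p m j)%N && (p <= m + 2 * p - expo p m j)%N = false.
Proof. by rewrite /expo; case: ifP => ?; lia. Qed.

Lemma expo_subnKC j : (j < 2 * p)%N ->
  (expo p m j + (m + 2 * p - expo p m j))%N = (m + 2 * p)%N.
Proof. by rewrite /expo; case: ifP => ?; lia. Qed.

(** The left side reads the column of M_m off the zeta-exponent; [goursat_coefficients] indexes its
    boundary unknowns this way. *)
Lemma expo_index j : (j < 2 * p)%N ->
  (if (expo p m j < p)%N then expo p m j else (expo p m j - m - 1)%N) = j.
Proof.
rewrite /expo; case: (ltnP j p) => [jp|pj jp]; first by rewrite jp.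
have -> : (m + j + 1 < p)%N = false by lia.
lia.
Qed.

Lemma boundary_index_lt k l : (p <= k)%N && (p <= l)%N = false ->
  (k + l)%N = (m + 2 * p)%N ->
  ((if (k < p)%N then k else (k - m - 1)%N) < 2 * p)%N.
Proof. by case: ifP => ?; lia. Qed.

Lemma interior_sum k l : (p <= k)%N -> (p <= l)%N ->
  (k + l)%N = (k - p + (l - p) + 2 * p)%N.
Proof. by lia. Qed.

Lemma interior_subn k : (k <= m)%N -> (m + 2 * p - (k + p))%N = (m - k + p)%N.
Proof. by lia. Qed.

End ExponentArithmetic.

(** * Uniqueness, coefficients of the solution, and the quotient by [Pa] *)

Section GoursatProblem.
Variables (R : realType) (p : nat) (a : nat -> R).
Hypothesis node_injective :
  forall i j, (i < 2 * p)%N -> (j < 2 * p)%N -> node a i = node a j -> i = j.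
Hypothesis det_neq0 : forall m : nat, \det (Mmat m p a) != 0.
Implicit Types (r : \bar R) (c : nat -> nat -> R[i]) (f : R * R -> R[i]) (z : R * R).

Lemma uniq_nodes : uniq [seq node a i | i <- iota 0 (2 * p)].
Proof.
rewrite map_inj_in_uniq ?iota_uniq // => i j.
by rewrite !mem_iota !add0n => /andP[_ hi] /andP[_ hj]; apply: node_injective.
Qed.

Lemma hsum_node_pt c m i :
  hsum c m (zc (node_pt a i)) (zcc (node_pt a i)) =
    zcc (node_pt a i) ^+ m * hsum c m (node a i) 1.
Proof. by rewrite -hsum_scale mulr1 zc_node_pt mulrC. Qed.

Lemma boundary_solve m (b : nat -> R[i]) (B : R) :
  (forall i, (i < 2 * p)%N -> cmod (b i) <= B) ->
  exists x : nat -> R[i],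
    (forall i, (i < 2 * p)%N -> \sum_(j < 2 * p) x j * node a i ^+ expo p m j = b i) /\
    (forall j, (j < 2 * p)%N ->
      cmod (x j) <= ((2 * p)`! * (2 * p))%:R * B / cmod (\det (Mmat m p a))).
Proof.
move=> bB.
have [|x Mx xB] := cramer_bound (b := \col_(i < 2 * p) b i) (B := B) (@Mmat_entry_le1 R p a m) (det_neq0 m).
  by move=> i; rewrite mxE bB.
(* Indices outside the matrix get the value 0; plain functions on the naturals can be chosen for all
   m at once. *)
exists (fun j => if insub j is Some j' then x j' 0 else 0); split=> [i hi|j hj].
  move/matrixP: Mx => /(_ (Ordinal hi) 0); rewrite !mxE /= => <-.
  by apply: eq_bigr => j _; rewrite valK MmatE mulrC.
by rewrite insubT.
Qed.

(** Below degree 2p, setting zeta' = 1 gives a polynomial of degree less than 2p with 2p distinct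
    roots. From degree 2p on, the interior coefficients vanish and the boundary ones form a vector
    in the kernel of M_m. *)
Lemma coef_eq0_of_nodes c N : (forall k l, c (k + p)%N (l + p)%N = 0) ->
  (forall i, (i < 2 * p)%N -> hsum c N (node a i) 1 = 0) ->
  forall k, (k <= N)%N -> c k (N - k)%N = 0.
Proof.
move=> cint cnode k kN.
have [Np|pN] := ltnP N (2 * p).
  pose P := \poly_(k < N.+1) c k (N - k)%N.
  suff P0 : P = 0 by have := coef_poly N.+1 (fun k => c k (N - k)%N) k; rewrite -/P P0 coef0 ltnS kN.
  apply/eqP/negPn/negP => P0.
  have rP : all (root P) [seq node a i | i <- iota 0 (2 * p)].
    apply/allP => _ /mapP[i + ->]; rewrite mem_iota add0n => /andP[_ hi].
    apply/rootP; rewrite horner_poly -[RHS](cnode i hi); apply: eq_bigr => j _.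
    by rewrite expr1n mulr1.
  have := max_poly_roots P0 rP uniq_nodes.
  by rewrite size_map size_iota ltnNge (leq_trans (size_poly _ _)).
have [m eN] : exists m, N = (m + 2 * p)%N by exists (N - 2 * p)%N; rewrite subnK.
subst N.
have col0 (j : 'I_(2 * p)) : c (expo p m j) (m + 2 * p - expo p m j)%N = 0.
  pose x : 'cV[R[i]]_(2 * p) := \col_j c (expo p m j) (m + 2 * p - expo p m j)%N.
  suff x0 : x = 0 by have := congr1 (fun y : 'cV__ => y j 0) x0; rewrite !mxE.
  have Mu : Mmat m p a \in unitmx by rewrite unitmxE unitfE det_neq0.
  rewrite -[x](mulKmx Mu) (_ : _ *m x = 0) ?mulmx0 //.
  apply/matrixP => i j'; rewrite !mxE.
  rewrite -[RHS](cnode i (ltn_ord i)) /hsum.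
  rewrite (sum_split_expo (fun k => c k (m + 2 * p - k)%N * (node a i ^+ k * 1 ^+ (m + 2 * p - k)))).
  rewrite [X in _ = _ + X]big1 ?addr0.
    by apply: eq_bigr => l _; rewrite MmatE mxE expr1n mulr1 mulrC.
  by move=> l _; rewrite interior_subn ?cint ?mul0r // -ltnS.
have [kp|pk] := ltnP k p.
  have kp2 : (k < 2 * p)%N by lia.
  by have := col0 (Ordinal kp2); rewrite /expo /= kp.
have [km|mk] := leqP k (m + p).
  have e1 : (k = (k - p) + p)%N by lia.
  have e2 : (m + 2 * p - k = (m + p - k) + p)%N by lia.
  by rewrite e2 e1 cint.
have kp2 : (k - m - 1 < 2 * p)%N by lia.
have := col0 (Ordinal kp2); rewrite /expo /=.
have -> : (k - m - 1 < p)%N = false by lia.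
by have -> : (m + (k - m - 1) + 1 = k)%N by lia.
Qed.

Definition goursat_solution r f g u :=
  Aan r u /\
  (forall z, disc r z -> iter p (@laplace R) u z = f z) /\
  (exists q : R * R -> R[i], Aan r q /\
     forall z, disc r z -> u z - g z = (Pa p a z)%:C * q z).

Lemma Pa_node_pt t i : (0 < p)%N -> (i < 2 * p)%N ->
  Pa p a (t * (node_pt a i).1, t * (node_pt a i).2) = 0.
Proof.
move=> p0 hi; have [kappa _ hP] := Pa_factor a p0.
apply: (@complexI R); rewrite hP rmorph0 (bigD1 (Ordinal hi)) //=.
set e := node_pt a i.
have -> : zc (t * e.1, t * e.2) = t%:C * zc e by rewrite /zc; simpc.
have -> : zcc (t * e.1, t * e.2) = t%:C * zcc e by rewrite /zcc; simpc.
have -> : t%:C * zc e - node a i * (t%:C * zcc e) = 0.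
  by rewrite /e zc_node_pt; ring.
by rewrite mul0r mulr0.
Qed.

(** Both solutions agree with g on the 2p lines, and equal iterated Laplacians force equal
    coefficients wherever both exponents are at least p. *)
Lemma goursat_unique r f g u v : (0 < p)%N -> (0 < r)%E ->
  goursat_solution r f g u -> goursat_solution r f g v ->
  forall z, disc r z -> v z = u z.
Proof.
move=> p0 r0 [Au [Lu [qu [_ hu]]]] [Av [Lv [qv [_ hv]]]] z dz.
have [cu su] := Aan_series r0 Au; have [cv sv] := Aan_series r0 Av.
have eL k l : iter p (@lap R) cu k l = iter p (@lap R) cv k l.
  apply: (series_unique r0 (series_iter_laplace p su) (series_iter_laplace p sv)) => w dw.
  by rewrite Lu ?Lv.
pose c k l := cu k l - cv k l.
have cint k l : c (k + p)%N (l + p)%N = 0.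
  have /eqP := eL k l; rewrite !iter_lap -subr_eq0 -mulrBr mulf_eq0.
  by rewrite pnatr_eq0 -leqn0 leqNgt lap_weight_gt0 => /eqP.
have cn N i : (i < 2 * p)%N -> hsum c N (node a i) 1 = 0.
  move=> hi; apply: (mulfI (expf_neq0 N (zcc_node_pt_neq0 a i))).
  rewrite mulr0 -hsum_node_pt hsumB; apply/eqP; rewrite subr_eq0; apply/eqP.
  apply: (series_line_unique r0 su sv) => t dt.
  have := hu _ dt; have := hv _ dt; rewrite Pa_node_pt // !mul0r.
  by move=> /eqP; rewrite subr_eq0 => /eqP -> /eqP; rewrite subr_eq0 => /eqP.
apply: csums_unique (sv.2 z dz) _; apply: eq_csums (su.2 z dz) => m.
apply: eq_hsum => k l _; apply/eqP; rewrite -subr_eq0; apply/eqP.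
by have := coef_eq0_of_nodes cint (cn (k + l)%N) (leq_addr l k); rewrite addKn.
Qed.

Lemma cmod_div_nat_le (x : R[i]) n : (0 < n)%N -> cmod (x / n%:R) <= cmod x.
Proof.
move=> n0; rewrite cmodM cmodV cmod_nat ler_pdivrMr ?ltr0n //.
by rewrite ler_peMr ?cmod_ge0 // ler1n.
Qed.

(** For finite r, s is halfway between rho / r and t; for infinite r any s below t works. Later s is
    spent on the determinants and rho' on the data. *)
Lemma radius_split (t rho : R) r : 0 < t -> (0 < r)%E -> 0 < rho ->
  (rho%:E < t%:E * r)%E ->
  exists s rho' : R, [/\ 0 < s, s < t, 0 < rho', (rho'%:E < r)%E & rho = s * rho'].
Proof.
move=> t0 r0 rho0; case: r r0 => [x||] //=.
  rewrite lte_fin -EFinM lte_fin => x0 rtx.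
  have rx : rho / x < t by rewrite ltr_pdivrMr.
  have rx0 : 0 < rho / x by apply: divr_gt0.
  pose s := (rho / x + t) / 2.
  have s1 : rho / x < s by rewrite /s; lra.
  have s0 : 0 < s by lra.
  exists s, (rho / s); split => //; [rewrite /s; lra|exact: divr_gt0| |].
    rewrite lte_fin ltr_pdivrMr // mulrC -ltr_pdivrMr //.
  by rewrite mulrC divfK // lt0r_neq0.
move=> _ _; exists (t / 2), (rho / (t / 2)); split; rewrite ?ltry //; try lra.
  by rewrite divr_gt0 //; lra.
by rewrite mulrC divfK // lt0r_neq0 //; lra.
Qed.

Lemma goursat_coefficients r (cf cg : nat -> nat -> R[i]) : (0 < r)%E ->
  (0 < tau p a)%E -> growth r cf -> growth r cg ->
  exists cu, [/\ growth (tau p a * r)%E cu,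
    (forall k l, iter p (@lap R) cu k l = cf k l),
    (forall k l, (k + l < 2 * p)%N -> cu k l = cg k l) &
    forall m i, (i < 2 * p)%N ->
      hsum cu (m + 2 * p) (node a i) 1 = hsum cg (m + 2 * p) (node a i) 1].
Proof.
move=> r0 tau0 gf gg.
have [t et] : exists t, tau p a = t%:E.
  have := tau_le1 p a; move: tau0; case: (tau p a) => [t||] //= _ _.
  by exists t.
have t0 : 0 < t by rewrite -lte_fin -et.
have t1 : t <= 1 by rewrite -lee_fin -et tau_le1.
have trr : (t%:E * r <= r)%E.
  by rewrite -[leRHS]mul1e lee_wpmul2r ?lee_fin // ltW.
(* Forced by the equation for the iterated Laplacian; [w k l] belongs to the exponents (k + p, l +
   p). *)
pose w k l := cf k l / (lap_weight p k l)%:R.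
have wle k l : cmod (w k l) <= cmod (cf k l) by apply/cmod_div_nat_le/lap_weight_gt0.
(* What the interior coefficients leave of the value of g at node i in degree m + 2p. *)
pose b m i := hsum cg (m + 2 * p) (node a i) 1 -
  \sum_(k < m.+1) w k (m - k)%N * node a i ^+ (k + p).
pose B m := \sum_(k < (m + 2 * p).+1) cmod (cg k (m + 2 * p - k)%N) +
  \sum_(k < m.+1) cmod (cf k (m - k)%N).
have bB m i : cmod (b m i) <= B m.
  apply: le_trans (cmodB _ _) _; apply: lerD.
    apply: le_trans (cmod_sum _ _ _) _; apply: ler_sum => k _.
    by rewrite cmodM expr1n mulr1 cmodX cmod_node expr1n mulr1.
  apply: le_trans (cmod_sum _ _ _) _; apply: ler_sum => k _.
  by rewrite cmodM cmodX cmod_node expr1n mulr1.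
have /choice[x hx] := fun m => boundary_solve m (fun i _ => bB m i).
(* Three cases: interior coefficients, low degrees copied from g, and the unknowns of the boundary
   system, located by their column. *)
pose cu k l := if (p <= k)%N && (p <= l)%N then w (k - p)%N (l - p)%N
  else if (k + l < 2 * p)%N then cg k l
  else x (k + l - 2 * p)%N (if (k < p)%N then k else (k - (k + l - 2 * p) - 1)%N).
exists cu; split.
- rewrite et; apply: (@growth_poly _ 1) => rho rho0 rr.
  have [Cf hCf] := gf _ rho0 (lt_le_trans rr trr).
  have [Cg hCg] := gg _ rho0 (lt_le_trans rr trr).
  have [s [rho' [s0 st rho'0 rr' erho]]] := radius_split t0 r0 rho0 rr.
  have [Cf' hCf'] := gf _ rho'0 rr'; have [Cg' hCg'] := gg _ rho'0 rr'.
  have [|D hD] := tau_det_bound det_neq0 s0; first by rewrite et lte_fin.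
  pose K : R := ((2 * p)`! * (2 * p))%:R.
  have K0 : 0 <= K by apply: ler0n.
  have nn (C C' : R) (h : forall k l : nat, cmod (cf k l) * C' ^+ (k + l) <= C) : 0 <= C.
    by have := h 0%N 0%N; rewrite expr0 mulr1; apply/le_trans/cmod_ge0.
  have nn' (C C' : R) (h : forall k l : nat, cmod (cg k l) * C' ^+ (k + l) <= C) : 0 <= C.
    by have := h 0%N 0%N; rewrite expr0 mulr1; apply/le_trans/cmod_ge0.
  have Cf0 := nn _ _ hCf; have Cg0 := nn' _ _ hCg.
  have Cf'0 := nn _ _ hCf'; have Cg'0 := nn' _ _ hCg'.
  have D0 : 0 <= D.
    by apply: le_trans (hD 0%N); rewrite expr0 mulr1 invr_ge0 cmod_ge0.
  pose E := Cg' + Cf' * rho' ^+ (2 * p).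
  have rp0 : 0 <= rho' ^+ (2 * p) by rewrite exprn_ge0 // ltW.
  have sp0 : 0 <= s ^+ (2 * p) by rewrite exprn_ge0 // ltW.
  have E0 : 0 <= E by rewrite addr_ge0 ?mulr_ge0.
  (* The number of terms in a block is the only polynomial loss, hence the exponent 1 given to
     [growth_poly]. *)
  have Bm m : B m * rho' ^+ (m + 2 * p) <= E * (m + 2 * p).+1%:R.
    rewrite /B mulrDl /E mulrDl; apply: lerD.
      rewrite mulr_suml mulr_natr -[X in _ *+ X](card_ord (m + 2 * p).+1) -sumr_const.
      apply: ler_sum => k _; have := hCg' k (m + 2 * p - k)%N.
      by rewrite ord_subnKC.
    apply: (@le_trans _ _ (Cf' * rho' ^+ (2 * p) * m.+1%:R)); last first.
      by rewrite ler_wpM2l ?mulr_ge0 // ler_nat ltnS leq_addr.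
    rewrite mulr_suml [leRHS]mulr_natr -[X in _ *+ X](card_ord m.+1) -sumr_const.
    apply: ler_sum => k _; rewrite exprD mulrA ler_wpM2r //.
    by have := hCf' k (m - k)%N; rewrite ord_subnKC.
  pose C1 := Cf * rho ^+ (2 * p); pose C3 := K * E * D * s ^+ (2 * p).
  have C10 : 0 <= C1 by rewrite mulr_ge0 // exprn_ge0 // ltW.
  have C30 : 0 <= C3 by rewrite !mulr_ge0.
  exists (C1 + Cg + C3) => k l; rewrite expr1.
  have N1 : 1 <= (k + l).+1%:R :> R by rewrite ler1n.
  have weak C : 0 <= C -> C <= C1 + Cg + C3 -> C <= (C1 + Cg + C3) * (k + l).+1%:R.
    by move=> C0 h; apply: le_trans h _; rewrite ler_peMr // !addr_ge0.
  rewrite /cu; case: ifP => [/andP[pk pl]|].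
    apply: (@le_trans _ _ C1); last by apply: weak => //; lra.
    rewrite (interior_sum pk pl) exprD mulrA /C1 ler_wpM2r ?exprn_ge0 ?(ltW rho0) //.
    apply: le_trans (hCf (k - p)%N (l - p)%N).
    by rewrite ler_wpM2r // exprn_ge0 // ltW.
  move=> npq; case: ifP => [_|klp].
    by apply: le_trans (hCg k l) _; apply: weak => //; lra.
  set m := (k + l - 2 * p)%N; set j := (if _ then _ else _).
  have ekl : (k + l)%N = (m + 2 * p)%N by rewrite /m subnK // leqNgt klp.
  have jp : (j < 2 * p)%N by rewrite /j; apply: boundary_index_lt npq ekl.
  apply: (@le_trans _ _ (C3 * (k + l).+1%:R)); last by rewrite ler_wpM2r //; lra.
  have [_ /(_ j jp) hj] := hx m; rewrite -/K in hj.
  apply: le_trans (ler_wpM2r (exprn_ge0 _ (ltW rho0)) hj) _.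
  rewrite ekl erho exprMn.
  (* Regrouped so that the full power of rho' meets the data and s^m meets the inverse determinant,
     leaving the constant s^(2p). *)
  have -> : K * B m / cmod (\det (Mmat m p a)) * (s ^+ (m + 2 * p) * rho' ^+ (m + 2 * p)) =
     K * (B m * rho' ^+ (m + 2 * p)) * ((cmod (\det (Mmat m p a)))^-1 * s ^+ m) * s ^+ (2 * p).
    by rewrite (exprD s); ring.
  have -> : C3 * (m + 2 * p).+1%:R = K * (E * (m + 2 * p).+1%:R) * D * s ^+ (2 * p).
    by rewrite /C3; ring.
  rewrite ler_wpM2r //; apply: ler_pM => //.
  + by rewrite !mulr_ge0 ?exprn_ge0 ?(ltW rho'0) // addr_ge0 // sumr_ge0 // => *; apply: cmod_ge0.
  + by rewrite mulr_ge0 ?invr_ge0 ?cmod_ge0 ?exprn_ge0 ?ltW.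
  + by rewrite ler_wpM2l.
- move=> k l; rewrite iter_lap /cu !leq_addl /= !addnK /w mulrC divfK //.
  by rewrite pnatr_eq0 -lt0n lap_weight_gt0.
- move=> k l klp; rewrite /cu klp; case: ifP => // /andP[pk pl].
  by move: klp; rewrite (interior_sum pk pl) ltnNge leq_addl.
- move=> m i hi; have [/(_ i hi) hxi _] := hx m.
  rewrite /hsum; set N := (m + 2 * p)%N; under eq_bigr do rewrite expr1n mulr1.
  rewrite (sum_split_expo (fun k => cu k (N - k)%N * node a i ^+ k)).
  have -> : \sum_(j < 2 * p) cu (expo p m j) (N - expo p m j)%N * node a i ^+ expo p m j = b m i.
    rewrite -hxi; apply: eq_bigr => j _; congr (_ * _).
    have jp := ltn_ord j; rewrite /cu expo_boundary // expo_subnKC //.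
    by rewrite ltnNge leq_addl /= addnK expo_index.
  rewrite /b; under [X in _ - X + _]eq_bigr => k _.
    have -> : w k (m - k)%N = cu (k + p)%N (N - (k + p))%N.
      by rewrite /cu interior_subn ?leq_addl /= ?addnK // -ltnS.
    over.
  by rewrite subrK.
Qed.

(** Each block of degree m + 2p vanishes at 2p distinct nodes, so [hpoly_divide] applies with a loss
    of (m + 2p + 1)^(2p); one more power comes from bounding the coefficients by a sum over the
    block. *)
Lemma goursat_quotient r c (kappa : R[i]) : growth r c ->
  (forall k l, (k + l < 2 * p)%N -> c k l = 0) ->
  (forall m i, (i < 2 * p)%N -> hsum c (m + 2 * p) (node a i) 1 = 0) ->
  kappa != 0 ->
  exists2 cq, growth r cq & forall m X Y,
    hsum c (m + 2 * p) X Y =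
      kappa * \prod_(i < 2 * p) (X - node a i * Y) * hsum cq m X Y.
Proof.
move=> gc c0 cn k0.
pose rs := [seq node a i | i <- iota 0 (2 * p)].
have srs : size rs = (2 * p)%N by rewrite size_map size_iota.
have urs : uniq rs := uniq_nodes.
pose Q m := \poly_(k < (m + 2 * p).+1) c k (m + 2 * p - k)%N.
pose B m := \sum_(k < (m + 2 * p).+1) cmod (c k (m + 2 * p - k)%N).
have hQ m X Y : hpoly (m + 2 * p) (Q m) X Y = hsum c (m + 2 * p) X Y.
  by apply: eq_bigr => k _; rewrite coef_poly ltn_ord.
have QB m k : cmod (Q m)`_k <= B m.
  have B0 : 0 <= B m by apply: sumr_ge0 => *; apply: cmod_ge0.
  rewrite coef_poly; case: ifP => [hk|_]; last by rewrite cmod0.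
  rewrite /B (bigD1 (Ordinal hk)) //= lerDl; apply: sumr_ge0 => *; exact: cmod_ge0.
have /choice[q hq] : forall m, exists q : {poly R[i]},
    (forall X Y, hsum c (m + 2 * p) X Y = \prod_(i < 2 * p) (X - node a i * Y) * hpoly m q X Y) /\
    (forall k, cmod q`_k <= (m + 2 * p).+1%:R ^+ (2 * p) * B m).
  move=> m.
  have [||q [hq bq]] := @hpoly_divide R rs m (Q m) (B m) urs _ _ (QB m).
  - move=> _ /mapP[i + ->]; rewrite mem_iota add0n => /andP[_ hi].
    rewrite cmod_node; split => //; apply/rootP; rewrite horner_poly -[RHS](cn m i hi).
    by apply: eq_bigr => j _; rewrite expr1n mulr1.
  - by rewrite srs size_poly.
  exists q; split => [X Y|k]; last by have := bq k; rewrite srs.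
  rewrite -hQ; have := hq X Y; rewrite srs => ->; congr (_ * _).
  by rewrite big_map -(big_mkord predT (fun i => X - node a i * Y)) /index_iota subn0.
exists (fun k l => kappa^-1 * (q (k + l)%N)`_k).
  apply: (@growth_poly _ (2 * p).+1) => rho rho0 rr; have [C hC] := gc _ rho0 rr.
  have C0 : 0 <= C.
    by have := hC 0%N 0%N; rewrite expr0 mulr1; apply/le_trans/cmod_ge0.
  exists (cmod kappa^-1 * ((2 * p).+1%:R ^+ (2 * p).+1 * C / rho ^+ (2 * p))) => k l.
  set m := (k + l)%N; set d := (2 * p)%N.
  have rd : 0 < rho ^+ d by apply: exprn_gt0.
  have Bm : B m * rho ^+ (m + d) <= (m + d).+1%:R * C.
    rewrite /B mulr_suml mulr_natl -[X in _ *+ X](card_ord (m + d).+1) -sumr_const.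
    apply: ler_sum => i _; have := hC i (m + d - i)%N.
    by rewrite ord_subnKC.
  have step : cmod (q m)`_k * rho ^+ m * rho ^+ d <= (m + d).+1%:R ^+ d.+1 * C.
    rewrite -mulrA -exprD exprSr -mulrA.
    apply: le_trans (ler_wpM2l (exprn_ge0 d (ler0n _ _)) Bm).
    rewrite mulrA ler_wpM2r ?exprn_ge0 ?(ltW rho0) //.
    by have [_] := hq m; apply.
  (* Turns powers of m + 2p + 1 into powers of m + 1, the form that [growth_poly] accepts. *)
  have md : (m + d).+1%:R <= d.+1%:R * m.+1%:R :> R.
    by rewrite -natrM ler_nat; nia.
  rewrite cmodM -!mulrA ler_wpM2l ?cmod_ge0 // !mulrA -(ler_pM2r rd).
  apply: le_trans step _; rewrite mulrAC divfK ?lt0r_neq0 //.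
  rewrite [leRHS]mulrAC -exprMn ler_wpM2r //.
  by rewrite lerXn2r // nnegrE ?mulr_ge0.
move=> m X Y; rewrite hsumZ; have [-> _] := hq m.
have -> : hsum (fun k l => (q (k + l)%N)`_k) m X Y = hpoly m (q m) X Y.
  by apply: eq_bigr => k _; rewrite ord_subnKC.
by rewrite mulrACA divff // mul1r.
Qed.

End GoursatProblem.

(* a_j (j = 1..2p-1) is a (j-1); Rad is R in (0, +oo] *)
Theorem theorem2p1 (R : realType) (p : nat) (a : nat -> R) (Rad : \bar R) :
  (0 < p)%N ->
  (forall i j, (i < (2 * p).-1)%N -> (j < (2 * p).-1)%N -> a i = a j -> i = j) ->
  (forall i, (i < (2 * p).-1)%N -> a i != 0) ->
  (0 < Rad)%E ->
  (forall m : nat, \det (Mmat m p a) != 0) ->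
  (0 < tau p a)%E ->
  forall f g : R * R -> R[i], Aan Rad f -> Aan Rad g ->
  let r := (tau p a * Rad)%E in
  let sol := fun u : R * R -> R[i] =>
    Aan r u /\
    (forall z, disc r z -> iter p (@laplace R) u z = f z) /\
    (exists q : R * R -> R[i], Aan r q /\
       forall z, disc r z -> u z - g z = (Pa p a z)%:C * q z) in
  exists u, sol u /\ forall v, sol v -> forall z, disc r z -> v z = u z.
Proof.
move=> p0 ainj _ Rad0 det0 tau0 f g Af Ag r sol.
have ninj := node_inj ainj.
have r0 : (0 < r)%E by rewrite mule_gt0.
have rRad : (r <= Rad)%E.
  by rewrite -[leRHS]mul1e /r lee_wpmul2r ?tau_le1 // ltW.
have [cf sf] := Aan_series Rad0 Af; have [cg sg] := Aan_series Rad0 Ag.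
have [cu [gu lapu lowu nodeu]] := goursat_coefficients det0 Rad0 tau0 sf.1 sg.1.
have [u su] := growth_has_series gu.
have {}sf := has_series_sub rRad sf; have {}sg := has_series_sub rRad sg.
have solu : sol u.
  split; first exact: series_Aan r0 su.
  split.
    move=> z dz; have [_ /(_ z dz) h] := series_iter_laplace p su.
    apply: csums_unique h _; apply: eq_csums (sf.2 z dz) => m.
    by apply: eq_hsum => k l _.
  pose c k l := cu k l - cg k l.
  have [kappa k0 hP] := Pa_factor a p0.
  have c0 k l : (k + l < 2 * p)%N -> c k l = 0 by move=> /lowu h; rewrite /c h subrr.
  have cn m i : (i < 2 * p)%N -> hsum c (m + 2 * p) (node a i) 1 = 0.
    by move=> hi; rewrite hsumB nodeu ?subrr.
  have [cq gq hq] := goursat_quotient ninj (growthB gu sg.1) c0 cn k0.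
  have [q sq] := growth_has_series gq.
  exists q; split; first exact: series_Aan r0 sq.
  move=> z dz; apply: csums_unique (csumsB (su.2 z dz) (sg.2 z dz)) _.
  (* Multiplication by [Pa] raises the degree by 2p, and the blocks of u - g below that degree
     vanish. *)
  apply: (@csums_shift _ (2 * p)) => [m mp|].
    rewrite -hsumB; apply: big1 => k _.
    by rewrite [X in X * _]c0 ?mul0r // ord_subnKC.
  apply: eq_csums (csumsZ (Pa p a z)%:C (sq.2 z dz)) => m.
  by rewrite -hsumB [RHS]hq hP.
exists u; split => // v solv z dz.
exact: (goursat_unique ninj det0 p0 r0 solu solv dz).
Qed.
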